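(* Let $\mathbb{F}_q$ be a finite field of characteristic $p$, let $f(x)\in\mathbb{F}_q[x]$ be a separable polynomial of degree $r\ge3$, and let $m\ge2$ be an integer with $p\nmid m$ and $\gcd(m,r)=1$. Let $\mathcal{X}$ be the curve $y^m=f(x)$ with function field $\mathbb{F}_q(\mathcal{X})=\mathbb{F}_q(x,y)$, let $\mathcal{X}(\mathbb{F}_q)$ be the set of $\mathbb{F}_q$-rational places of $\mathbb{F}_q(\mathcal{X})$, and let $Q_\infty$ be the unique place over the pole of $x$. Let $Q\neq Q_\infty$ be a rational place of $\mathbb{F}_q(\mathcal{X})$ which is totally ramified in the extension $\mathbb{F}_q(\mathcal{X})/\mathbb{F}_q(x)$. For $a\in\{2,\dots,r-1\}$ define $$G_a:=\left(am-\left\lfloor\frac{am}{r}\right\rfloor-1\right)Q\quad\text{and}\quad D:=\sum_{Q'\in\mathcal{X}(\mathbb{F}_q),\,Q'\ne Q}Q',$$ and assume that $\deg(G_a)<N:=\deg(D)$. Then the linear code $C_{\mathcal{L}}(D,G_a)$ has length $N$, dimension $$a+\sum_{i=1}^{a-1}\left\lfloor\frac{im}{r}\right\rfloor,$$ and minimum distance $d\ge N-m(a-1)$. In addition, if $\#\{\gamma\in\mathbb{F}_q\mid P_\gamma\text{ splits completely in }\mathbb{F}_q(\mathcal{X})/\mathbb{F}_q(x)\}\ge a-1$, where $P_\gamma$ denotes the place of $\mathbb{F}_q(x)$ that is the zero of $x-\gamma$, then the minimum distance of $C_{\mathcal{L}}(D,G_a)$ is exactly $d=N-m(a-1)$.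
   Context: For a divisor $D=P_1+\dots+P_N$ that is a sum of pairwise distinct rational (degree-one) places of a function field $F/\mathbb{F}_q$, and a divisor $G$ with support disjoint from that of $D$, the AG code is $C_{\mathcal{L}}(D,G)=\{(h(P_1),\dots,h(P_N))\mid h\in\mathcal{L}(G)\}\subseteq\mathbb{F}_q^N$, where $\mathcal{L}(G)=\{z\in F\mid (z)+G\ge0\}\cup\{0\}$. Minimum distance means minimum Hamming distance. $\lfloor\cdot\rfloor$ is the floor function. Separable means having no repeated roots in an algebraic closure. *)

(* Defs.v *)
From HB Require Import structures.
From mathcomp Require Import all_boot all_order all_algebra all_field.
From mathcomp Require Import boolp classical_sets.
From mathcomp Require Import freeg.

Set Implicit Arguments.
Unset Strict Implicit.
Unset Printing Implicit Defensive.
Import Order.TTheory GRing.Theory Num.Theory.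
Local Open Scope ring_scope.

(* A place of a field E over a constant field k (embedded by iota) is given
   by its normalized discrete valuation.  The value at 0, which should be
   +oo, is set to 0 so that equal places are equal records; for this reason
   every use of a valuation below treats the zero element separately. *)
Record place (k E : fieldType) (iota : {rmorphism k -> E}) := Place {
  pval :> E -> int;
  pval0 : pval 0 = 0;
  pval_const : forall c : k, pval (iota c) = 0;
  pvalM : forall z w : E, z != 0 -> w != 0 -> pval (z * w) = pval z + pval w;
  pvalD : forall z w : E, z != 0 -> w != 0 -> z + w != 0 ->
    Num.min (pval z) (pval w) <= pval (z + w);
  pval_uniformizer : exists t : E, pval t = 1
}.

HB.instance Definition _ (k E : fieldType) (iota : {rmorphism k -> E}) :=
  gen_eqMixin (place iota).
HB.instance Definition _ (k E : fieldType) (iota : {rmorphism k -> E}) :=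
  gen_choiceMixin (place iota).

Section Places.
Variables (k E : fieldType) (iota : {rmorphism k -> E}).
Implicit Types (P : place iota) (z : E).

Definition in_ring P z : bool := (z == 0) || (0 <= P z).
Definition in_ideal P z : bool := (z == 0) || (0 < P z).

(* The residue classes of b form a k-basis of the residue field of P. *)
Definition residue_basis P (d : nat) (b : 'I_d -> E) : Prop :=
  (forall i, in_ring P (b i)) /\
  forall z, in_ring P z ->
    exists! c : 'rV[k]_d, in_ideal P (z - \sum_i iota (c 0 i) * b i).

(* 0 if the residue field has infinite dimension, which does not happen in a
   function field. *)
Definition place_degree P : nat :=
  xget 0%N (fun d => exists b : 'I_d -> E, residue_basis P b).

Definition rational P : Prop := place_degree P = 1%N.

(* h is regular at P and h(P) = c *)
Definition has_value P (h : E) (c : k) : Prop := in_ideal P (h - iota c).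

Definition div_degree (D : {freeg (place iota)}) : int :=
  \sum_(P <- dom D) coeff P D * (place_degree P)%:Z.

Definition RR_space (G : {freeg (place iota)}) (z : E) : Prop :=
  z = 0 \/ forall P, 0 <= P z + coeff P G.

End Places.

Section AGCodes.
Variables (k : finFieldType) (E : fieldType) (iota : {rmorphism k -> E}).

Definition sum_places (n : nat) (ps : 'I_n -> place iota) :
  {freeg (place iota)} := \sum_i << ps i >>.

Definition AG_codeword (n : nat) (ps : 'I_n -> place iota)
    (G : {freeg (place iota)}) (c : 'rV[k]_n) : Prop :=
  exists2 h : E, RR_space G h & forall i, has_value (ps i) h (c 0 i).

(* C_L(D, G) for D = sum_places ps.  The span is only there to obtain a
   {vspace _}: it adds no vector, see AG_codeP. *)
Definition AG_code (n : nat) (ps : 'I_n -> place iota)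
    (G : {freeg (place iota)}) : {vspace 'rV[k]_n} :=
  <<[seq c <- enum 'rV[k]_n | `[< AG_codeword ps G c >]]>>%VS.

Lemma RR_space_lin (G : {freeg (place iota)}) (a : k) z w :
  RR_space G z -> RR_space G w -> RR_space G (iota a * z + w).
Proof.
case: (eqVneq (iota a * z) 0) => [-> _ | az0 Gz]; first by rewrite add0r.
have Gaz: forall P : place iota, 0 <= P (iota a * z) + coeff P G.
  move: az0; rewrite mulf_eq0 negb_or => /andP[a0 z0] P.
  case: Gz => [z00|Gz]; first by rewrite z00 eqxx in z0.
  by rewrite pvalM // pval_const add0r; apply: Gz.
case: (eqVneq w 0) => [-> _ | w0 Gw]; first by rewrite addr0; right.
case: (eqVneq (iota a * z + w) 0) => [-> | azw]; [by left | right => P].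
case: Gw => [w00|Gw]; first by rewrite w00 eqxx in w0.
have := pvalD P az0 w0 azw; rewrite ge_min -(lerD2r (coeff P G)) => /orP[].
  by apply: le_trans; apply: Gaz.
by rewrite -(lerD2r (coeff P G)); apply: le_trans; apply: Gw.
Qed.

Lemma has_value_lin (P : place iota) (a : k) h1 h2 c1 c2 :
  has_value P h1 c1 -> has_value P h2 c2 ->
  has_value P (iota a * h1 + h2) (a * c1 + c2).
Proof.
rewrite /has_value /in_ideal rmorphD rmorphM.
have ->: iota a * h1 + h2 - (iota a * iota c1 + iota c2) =
         iota a * (h1 - iota c1) + (h2 - iota c2).
  by rewrite mulrBr opprD addrACA.
move: (h1 - _) (h2 - _) => u v.
case: (eqVneq (iota a * u) 0) => [-> _ | au0 Hu]; first by rewrite add0r.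
have Hau: 0 < P (iota a * u).
  move: au0; rewrite mulf_eq0 negb_or => /andP[a0 u0].
  by move: Hu; rewrite (negPf u0) pvalM // pval_const add0r.
case: (eqVneq v 0) => [-> _ | v0 /= Hv]; first by rewrite addr0 Hau orbT.
case: (eqVneq (iota a * u + v) 0) => //= s0.
by apply: lt_le_trans (pvalD P au0 v0 s0); rewrite lt_min Hau Hv.
Qed.

Lemma AG_codeP (n : nat) (ps : 'I_n -> place iota) (G : {freeg (place iota)})
    (c : 'rV[k]_n) :
  c \in AG_code ps G <-> AG_codeword ps G c.
Proof.
have W0: AG_codeword ps G 0.
  exists 0; first by left.
  by move=> i; rewrite /has_value mxE rmorph0 subr0 /in_ideal eqxx.
have Wlin (a : k) u v : AG_codeword ps G u -> AG_codeword ps G v ->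
    AG_codeword ps G (a *: u + v).
  move=> [h1 G1 V1] [h2 G2 V2]; exists (iota a * h1 + h2).
    exact: RR_space_lin.
  by move=> i; rewrite !mxE; apply: has_value_lin.
split=> [|Wc]; last first.
  by apply: memv_span; rewrite mem_filter mem_enum andbT; apply/asboolP.
rewrite /AG_code; set s := filter _ _ => /(@coord_span _ _ _ (in_tuple s)) ->.
apply: (big_ind (AG_codeword ps G)) => // [u v Wu Wv | i _].
  by rewrite -[u]scale1r; apply: Wlin.
rewrite -[_ *: _]addr0; apply: Wlin => //.
have: (in_tuple s)`_i \in s by apply: mem_nth.
by rewrite mem_filter => /andP[/asboolP].
Qed.

End AGCodes.

Definition hamming_dist (R : eqType) (n : nat) (u v : 'rV[R]_n) : nat :=
  #|[pred i : 'I_n | u 0 i != v 0 i]|.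

Definition is_min_distance (k : finFieldType) (n : nat)
    (C : {vspace 'rV[k]_n}) (d : nat) : Prop :=
  (exists u v, [/\ u \in C, v \in C, u != v & hamming_dist u v = d]) /\
  (forall u v, u \in C -> v \in C -> u != v -> (d <= hamming_dist u v)%N).

Definition const_ratfun (k : fieldType) :
  {rmorphism k -> {fraction {poly k}}} := (@tofrac {poly k} \o polyC)%FUN.

(* Extensions F / k(x). *)
Section Extensions.
Variables (k : fieldType) (F : fieldExtType {fraction {poly k}}).

Definition const_ext : {rmorphism k -> F} :=
  (in_alg F \o const_ratfun k)%FUN.

Implicit Types (P : place const_ext) (p : place (const_ratfun k)).

Definition lies_over P p : Prop := forall z, in_ideal p z -> in_ideal P z%:A.

Definition is_ramification_index P p (e : nat) : Prop :=
  forall z, P z%:A = e%:Z * p z.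

(* \dim {:F} is the degree of the extension F / k(x). *)
Definition totally_ramified P : Prop :=
  exists2 p, lies_over P p & is_ramification_index P p (\dim {:F}).

Definition splits_completely p : Prop :=
  exists s : seq (place const_ext),
    [/\ uniq s, size s = \dim {:F} & forall P, P \in s <-> lies_over P p].

Definition splits_completely_at (c : k) : Prop :=
  exists2 p, in_ideal p (tofrac ('X - c%:P)) & splits_completely p.

(* p is the place at infinity of k(x): the pole of x. *)
Definition is_pole_of_x p : Prop := p (tofrac 'X) < 0.

End Extensions.

(* Main.v *)
Require Import Defs.
From HB Require Import structures.
From mathcomp Require Import all_boot all_order all_algebra all_field.
From mathcomp Require Import boolp classical_sets.
From mathcomp Require Import freeg perm.
From mathcomp Require Import zify ring.
Import Order.TTheory GRing.Theory Num.Theory.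
Local Open Scope ring_scope.
Set Implicit Arguments.
Unset Strict Implicit.
Unset Printing Implicit Defensive.

(** The field F is explicit enough for everything to be computed with
    polynomials.  As m is prime to r, at a pole of x the summands of
    g_0(x) + g_1(x) y + ... + g_(m-1)(x) y^(m-1) have orders that are pairwise
    incongruent modulo m, so they cannot cancel.  This gives [F : k(x)] = m, a
    single place Qoo above the pole of x, and the order of any expression there
    (pval_inf).  The same happens at Q: total ramification forces f(al) = 0 for
    the value al of x at Q (totally_ramified_root), so that y has order 1 and
    x - al has order m at Q.

    A function z in L(G) has no pole off Q.  Any irreducible polynomial other
    than x - al in the denominator of z would produce one (place_above_pole,
    denominator_at_Q), hence z = g(x, y)/(x - al)^n.  The order at Qoo bounds the
    degrees of the coefficients of g, and comparing it with the order at Q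
    (pole_order_gap) allows n = a - 1.  So L(G) is the span of the
    y^i/(x - al)^j with 0 <= j < a and r i <= m j; in other words
    L(G) = L(m(a-1)Q).  There are a + sum_(1 <= i < a) floor(im/r) of them
    (card_monomials), and evaluation is injective on L(G), because a nonzero
    h in L(G) has at most m(a-1) zeros among the rational places, fewer than
    their number (zeros_le).  The same bound on zeros gives the minimum
    distance, and if x takes a - 1 completely split values c, the product of
    the (x - c)/(x - al) has m(a-1) rational zeros (many_zeros).

    The places needed in the second paragraph have to be constructed.  A prime
    ideal of k[x, y] that is generated locally by one element t defines a
    valuation, the exponent of t (local_place).  Above an irreducible p one can
    take t = y if p divides f, and t = p otherwise (ramified_local_prime,
    unramified_local_prime).  The same description shows that a rational place
    is determined by the values of x and y, which identifies rational places
    with points.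

    Zeros are counted without divisor theory.  Multiplication by g on
    k[x][y]/(y^m - f) is a matrix over k[x].  Its determinant has degree at most
    m(a-1), and for every c it is divisible by x - c to the power of the number
    of common zeros (c, b) of g and y^m - f, since these give independent kernel
    vectors of the matrix specialized at c (zero_count). *)

(** * Valuations of a place *)

Section PlaceTheory.
Variables (k E : fieldType) (iota : {rmorphism k -> E}).
Implicit Types (P : place iota) (z w : E).

Lemma pval1 P : P 1 = 0.
Proof. by rewrite -(rmorph1 iota) pval_const. Qed.

Lemma pvalN P z : P (- z) = P z.
Proof.
have [->|z0] := eqVneq z 0; first by rewrite oppr0.
rewrite -mulN1r pvalM ?oppr_eq0 ?oner_eq0 //.
by rewrite -(rmorph1 iota) -rmorphN pval_const add0r.
Qed.

Lemma pvalX P z n : z != 0 -> P (z ^+ n) = P z *+ n.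
Proof.
move=> z0; elim: n => [|n IH]; first by rewrite expr0 pval1.
by rewrite exprS pvalM ?expf_neq0 // IH mulrS.
Qed.

Lemma pvalV P z : P z^-1 = - P z.
Proof.
have [->|z0] := eqVneq z 0; first by rewrite invr0 pval0.
apply/eqP; rewrite -subr_eq0 opprK addrC -pvalM ?invr_eq0 //.
by rewrite divff // pval1.
Qed.

Lemma pval_exprz P z (n : int) : z != 0 -> P (z ^ n) = P z * n.
Proof.
move=> z0; case: n => n; first by rewrite -exprnP pvalX // -mulr_natr natz.
by rewrite NegzE -exprnN pvalV pvalX // -mulr_natr natz mulrN.
Qed.

(** The stored value of 0 is 0 and not +oo, so 0 has to be let in by hand.  The
    cases n = 0 and n = 1 are in_ring and in_ideal. *)
Definition pge P (n : int) z : bool := (z == 0) || (n <= P z).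

Lemma pge0 P n : pge P n 0.
Proof. by rewrite /pge eqxx. Qed.

Lemma pgeD P n z w : pge P n z -> pge P n w -> pge P n (z + w).
Proof.
rewrite /pge.
have [->|z0] := eqVneq z 0; first by rewrite add0r.
have [->|w0] := eqVneq w 0; first by rewrite addr0 (negPf z0).
have [->|s0] //= := eqVneq (z + w) 0.
by move=> Hz Hw; apply: le_trans (pvalD P z0 w0 s0); rewrite le_min Hz.
Qed.

Lemma pgeM P n n' z w : pge P n z -> pge P n' w -> pge P (n + n') (z * w).
Proof.
rewrite /pge mulf_eq0.
have [//|z0] := eqVneq z 0; have [//|w0] /= := eqVneq w 0.
by rewrite pvalM //; apply: lerD.
Qed.

Lemma pgeN P n z : pge P n (- z) = pge P n z.
Proof. by rewrite /pge oppr_eq0 pvalN. Qed.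

Lemma pge_sum P n (I : Type) (s : seq I) (A : pred I) (T : I -> E) :
  (forall i, A i -> pge P n (T i)) -> pge P n (\sum_(i <- s | A i) T i).
Proof. by move=> H; apply: (big_ind (pge P n)) => //; [apply: pge0 | move=> *; apply: pgeD]. Qed.

Lemma in_ringE P z : in_ring P z = pge P 0 z. Proof. by []. Qed.

Lemma in_idealE P z : in_ideal P z = pge P 1 z.
Proof. by rewrite /in_ideal /pge -gtz0_ge1. Qed.

Lemma in_ideal_ring P z : in_ideal P z -> in_ring P z.
Proof. by case/orP=> H; rewrite /in_ring ?H // (ltW H) orbT. Qed.

Lemma in_ringX P z n : in_ring P z -> in_ring P (z ^+ n).
Proof.
move=> Hz; elim: n => [|n IH]; first by rewrite /in_ring expr0 pval1 lexx orbT.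
by rewrite exprS; apply: (pgeM (n := 0) (n' := 0)).
Qed.

Lemma in_ideal1 P : in_ideal P 1 = false.
Proof. by rewrite /in_ideal oner_eq0 pval1 ltxx. Qed.

Lemma in_ideal_const P c : in_ideal P (iota c) = (c == 0).
Proof. by rewrite /in_ideal pval_const ltxx orbF fmorph_eq0. Qed.

Lemma in_ring_const P c : in_ring P (iota c).
Proof. by rewrite /in_ring pval_const lexx orbT. Qed.

Lemma in_idealD P z w : in_ideal P z -> in_ideal P w -> in_ideal P (z + w).
Proof. by rewrite !in_idealE; apply: pgeD. Qed.

Lemma in_idealN P z : in_ideal P (- z) = in_ideal P z.
Proof. by rewrite !in_idealE pgeN. Qed.

Lemma in_idealMr P z w : in_ring P z -> in_ideal P w -> in_ideal P (z * w).
Proof. by rewrite !in_idealE in_ringE -[1]add0r; apply: pgeM. Qed.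

Lemma in_idealMl P z w : in_ideal P z -> in_ring P w -> in_ideal P (z * w).
Proof. by rewrite mulrC => ? ?; apply: in_idealMr. Qed.

Lemma in_idealX P z n : in_ideal P (z ^+ n) -> in_ideal P z.
Proof.
rewrite /in_ideal expf_eq0; have [->|z0] /= := eqVneq z 0; first by [].
rewrite andbF pvalX //=; case: n => [|n]; first by rewrite mulr0n ltxx.
by rewrite pmulrn_lgt0.
Qed.

Lemma pval_unit P z : in_ring P z -> ~~ in_ideal P z -> P z = 0.
Proof.
rewrite /in_ring /in_ideal negb_or; case: eqVneq => //= _ H.
by rewrite -leNgt => H'; apply/eqP; rewrite eq_le H H'.
Qed.

Lemma in_ideal_prime P z w : in_ring P z -> in_ring P w ->
  in_ideal P (z * w) -> in_ideal P z || in_ideal P w.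
Proof.
move=> Rz Rw; apply: contraLR; rewrite negb_or => /andP[Iz Iw].
have := pval_unit Rz Iz; have := pval_unit Rw Iw.
move: Iz Iw; rewrite /in_ideal !negb_or mulf_eq0 => /andP[z0 _] /andP[w0 _] Pw Pz.
by rewrite (negPf z0) (negPf w0) pvalM // Pz Pw ltxx.
Qed.

Lemma pval_congr P z w : w != 0 -> P w = 0 -> in_ideal P (z - w) -> z != 0 /\ P z = 0.
Proof.
move=> w0 Pw Hzw; have Hw: ~~ in_ideal P w by rewrite /in_ideal (negPf w0) Pw ltxx.
have Rw : in_ring P w by rewrite /in_ring Pw lexx orbT.
have Hz: ~~ in_ideal P z.
  apply: contra Hw => Hz; rewrite -[w](subKr z); apply: in_idealD => //.
  by rewrite in_idealN.
split; first by apply: contra Hz => /eqP->; rewrite /in_ideal eqxx.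
apply: pval_unit => //; rewrite -[z](subrK w); apply: pgeD => //.
exact: in_ideal_ring.
Qed.

Lemma pvalD_lt P z w : z != 0 -> (w = 0 \/ P z < P w) ->
  z + w != 0 /\ P (z + w) = P z.
Proof.
move=> z0 H; have [->|w0] := eqVneq w 0; first by rewrite addr0.
have {}H: P z < P w by case: H => // w00; rewrite w00 eqxx in w0.
have s0: z + w != 0.
  by apply: contraTneq H => /eqP; rewrite addr_eq0 => /eqP ->; rewrite pvalN ltxx.
split=> //; apply/eqP; rewrite eq_le andbC.
have := pvalD P z0 w0 s0; rewrite min_l ?(ltW H) // => -> /=.
have w0' : - w != 0 by rewrite oppr_eq0.
have:= pvalD P s0 w0'; rewrite addrK => /(_ z0); rewrite ge_min pvalN.
by case/orP=> [//|/(lt_le_trans H)]; rewrite ltxx.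
Qed.

(** When two terms have different values, the smaller value survives in the sum. *)
Lemma pval_sum_distinct P (I : eqType) (s : seq I) (T : I -> E) :
  uniq s ->
  {in s &, forall i j, T i != 0 -> T j != 0 -> P (T i) = P (T j) -> i = j} ->
  has (fun i => T i != 0) s ->
  \sum_(i <- s) T i != 0 /\
  exists2 i, i \in s & [/\ T i != 0, P (\sum_(i <- s) T i) = P (T i) &
     {in s, forall j, T j != 0 -> P (T i) <= P (T j)}].
Proof.
elim: s => //= i s IH /andP[iNs us] inj.
have inj' : {in s &, forall i j, T i != 0 -> T j != 0 -> P (T i) = P (T j) -> i = j}.
  by move=> u v us' vs; apply: inj; rewrite inE ?us' ?vs orbT.
rewrite big_cons; case: (boolP (has _ s)) => [hs _|hs].
  have [S0 [j js [Tj SE jmin]]] := IH us inj' hs.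
  have [Ti0 | Ti0] := eqVneq (T i) 0.
    rewrite Ti0 add0r; split=> //; exists j; first by rewrite inE js orbT.
    split=> // l; rewrite inE => /orP[/eqP->|]; [by rewrite Ti0 eqxx|exact: jmin].
  have [lij|lji|eij] := ltgtP (P (T i)) (P (T j)).
  - have [ | A B] := @pvalD_lt P _ (\sum_(l <- s) T l) Ti0; first by right; rewrite SE.
    split=> //; exists i; first by rewrite inE eqxx.
    split=> // l; rewrite inE => /orP[/eqP->//|ls Tl].
    by apply: ltW; apply: lt_le_trans lij _; apply: jmin.
  - have [ | A B] := @pvalD_lt P _ (T i) S0; first by right; rewrite SE.
    rewrite addrC; split=> //; exists j; first by rewrite inE js orbT.
    rewrite -SE B; split=> // l; rewrite inE => /orP[/eqP->//|ls Tl]; rewrite SE.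
      by move=> _; apply: ltW.
    exact: jmin.
  - have ij : i = j by apply: inj => //; rewrite ?inE ?eqxx ?js ?orbT.
    by rewrite ij js in iNs.
rewrite orbF => Ti0; have S0: \sum_(l <- s) T l = 0.
  rewrite big_seq big1 // => l ls; apply/eqP; apply: contraNT hs => Tl.
  by apply/hasP; exists l.
rewrite S0 addr0; split=> //; exists i; first by rewrite inE eqxx.
split=> // l; rewrite inE => /orP[/eqP->//|ls Tl].
by case/negP: hs; apply/hasP; exists l.
Qed.

Lemma place_eq P P' : (forall z, z != 0 -> P z = P' z) -> P = P'.
Proof.
move=> H; have {H}: Defs.pval P = Defs.pval P'.
  apply: funext => z; have [-> | ] := eqVneq z 0; first by rewrite !pval0.
  exact: H.
case: P P' => [v a b c d e] [v' a' b' c' d' e'] /= vv'; subst v'.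
by congr Place; apply: Prop_irrelevance.
Qed.

Lemma residue_basis1 P : (forall z, in_ring P z -> exists c, in_ideal P (z - iota c)) ->
  residue_basis P (fun _ : 'I_1 => 1 : E).
Proof.
move=> H; split=> [_|z Rz]; first by rewrite /in_ring pval1 lexx orbT.
have [c Hc] := H z Rz; exists (const_mx c); split.
  by rewrite big_ord1 mxE mulr1.
move=> c'; rewrite big_ord1 mulr1 => Hc'; apply/rowP=> i; rewrite mxE (ord1 i).
apply/eqP; rewrite -subr_eq0 -(in_ideal_const P) rmorphB.
have -> : iota c - iota (c' 0 0) = (z - iota (c' 0 0)) - (z - iota c) by ring.
by apply: in_idealD => //; rewrite in_idealN.
Qed.

Lemma rational_value P z : rational P -> in_ring P z -> exists c, has_value P z c.
Proof.
rewrite /rational /place_degree; case: xgetP => //= d _ [b [Rb Hb]] d1; subst d.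
have Hc w : in_ring P w -> exists c, in_ideal P (w - iota c * b ord0).
  by case/Hb=> c []; rewrite big_ord1; exists (c 0 0).
have R1 : in_ring P 1 by rewrite /in_ring pval1 lexx orbT.
(* b spans the residue field, so it is the inverse of c1 there. *)
have [c1 H1] := Hc 1 R1; move=> /Hc[c Hz].
have c10 : c1 != 0.
  by apply: contraTneq H1 => ->; rewrite rmorph0 mul0r subr0 in_ideal1.
exists (c / c1); rewrite /has_value.
have -> : z - iota (c / c1) =
    (z - iota c * b ord0) - iota (c / c1) * (1 - iota c1 * b ord0).
  rewrite mulrBr mulr1 mulrA -rmorphM divfK //; ring.
apply: in_idealD => //; rewrite in_idealN.
by apply: in_idealMr => //; apply: in_ring_const.
Qed.

Lemma has_value_unique P z c c' : has_value P z c -> has_value P z c' -> c = c'.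
Proof.
rewrite /has_value => H H'; apply/eqP; rewrite -subr_eq0 -(in_ideal_const P) rmorphB.
have -> : iota c - iota c' = (z - iota c') - (z - iota c) by ring.
by apply: in_idealD => //; rewrite in_idealN.
Qed.

End PlaceTheory.

(** The degree is well defined because the constant field is finite: the number
    of residue classes determines the dimension of any residue basis. *)
Lemma rationalI (k : finFieldType) (E : fieldType) (iota : {rmorphism k -> E})
    (P : place iota) :
  (forall z, in_ring P z -> exists c, has_value P z c) -> rational P.
Proof.
move=> /[dup] Hv /residue_basis1 H1; rewrite /rational /place_degree.
apply: xget_unique; first by exists (fun=> 1).
move=> d [b [Rb Hb]].
have Rsum (c : 'rV[k]_d) : in_ring P (\sum_i iota (c 0 i) * b i).
  apply: pge_sum => i _; apply: (pgeM (n := 0) (n' := 0)); [exact: in_ring_const | exact: Rb].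
have /fin_all_exists[F HF] (c : 'rV[k]_d) := Hv _ (Rsum c).
have Fbij : bijective F.
  have /fin_all_exists[G HG] (c : k) := Hb _ (in_ring_const P c).
  exists G => c.
    case: (HG (F c)) => _; apply; rewrite -opprB in_idealN; exact: HF.
  apply: (has_value_unique (HF _)).
  by case: (HG c) => + _; rewrite -opprB in_idealN.
have := bij_eq_card Fbij; rewrite card_mx mul1n -{2}[#|k|]expn1 => /eqP.
by rewrite eqn_exp2l ?card_finNzRing_gt1 // => /eqP.
Qed.

(** * Elements of F as expressions in x and y *)

Section CommonDenominator.
Variable R : idomainType.

Lemma fracP (z : {fraction R}) : exists u v : R, v != 0 /\ z * tofrac v = tofrac u.
Proof.
elim/quotW: z => x; exists (frac x).1, (frac x).2; split; first exact: denom_ratioP.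
unlock FracField.tofrac; rewrite -[LHS]FracField.pi_mul; apply/eqmodP => /=.
rewrite FracField.equivfE /FracField.mulf /= !numden_Ratio ?(oner_neq0, mulf_neq0, denom_ratioP) //.
by rewrite !mulr1 mulrC.
Qed.

Lemma poly_fracP (q : {poly {fraction R}}) : exists g (v : R),
  v != 0 /\ map_poly (@tofrac R) g = tofrac v *: q.
Proof.
elim/poly_ind: q => [|q c [g [v [v0 E]]]].
  by exists 0, 1; rewrite oner_neq0 rmorph0 scaler0.
have [u [w [w0 Ew]]] := fracP c.
exists (w *: g * 'X + (v * u)%:P), (v * w); split; first by rewrite mulf_neq0.
rewrite rmorphD rmorphM /= map_polyX map_polyC map_polyZ E /= !tofracM -Ew.
rewrite scalerDr -!mul_polyC !polyCM /=; ring.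
Qed.

End CommonDenominator.

Section XY.
Variables (k : fieldType) (F : fieldExtType {fraction {poly k}}).

Definition xpoly (g : {poly k}) : F := (tofrac g)%:A.

HB.instance Definition _ := GRing.RMorphism.copy xpoly
  (in_alg F \o @tofrac {poly k})%FUN.

Lemma xpolyC c : xpoly c%:P = const_ext F c.
Proof. by []. Qed.

Lemma xpoly_eq0 g : (xpoly g == 0) = (g == 0).
Proof. by rewrite /xpoly scaler_eq0 oner_eq0 orbF tofrac_eq0. Qed.

Variable y : F.

Definition xyeval (g : {poly {poly k}}) : F := (map_poly xpoly g).[y].

HB.instance Definition _ := GRing.RMorphism.copy xyeval
  (horner_eval y \o map_poly xpoly)%FUN.

Lemma xyevalC g : xyeval g%:P = xpoly g.
Proof. by rewrite /xyeval map_polyC hornerC. Qed.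

Lemma xyevalX : xyeval 'X = y.
Proof. by rewrite /xyeval map_polyX hornerX. Qed.

Lemma xyevalD (g h : {poly {poly k}}) : xyeval (g + h) = xyeval g + xyeval h.
Proof. exact: rmorphD. Qed.

Lemma xyevalB (g h : {poly {poly k}}) : xyeval (g - h) = xyeval g - xyeval h.
Proof. exact: rmorphB. Qed.

Lemma xyevalM (g h : {poly {poly k}}) : xyeval (g * h) = xyeval g * xyeval h.
Proof. exact: rmorphM. Qed.

Lemma xyeval_exp (g : {poly {poly k}}) n : xyeval (g ^+ n) = xyeval g ^+ n.
Proof. exact: rmorphXn. Qed.

Definition xyevalE := (xyevalB, xyevalD, xyevalM, xyeval_exp, xyevalC, xyevalX).

Lemma xyeval_wide n (g : {poly {poly k}}) : (size g <= n)%N ->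
  xyeval g = \sum_(i < n) xpoly g`_i * y ^+ i.
Proof.
move=> gn; rewrite /xyeval (@horner_coef_wide _ n) ?(leq_trans (size_poly _ _)) //.
by apply: eq_bigr => i _; rewrite coef_map.
Qed.

Lemma xpolyE (g : {poly k}) : xpoly g = (map_poly (const_ext F) g).[xpoly 'X].
Proof.
elim/poly_ind: g => [|g c IH]; first by rewrite !rmorph0 horner0.
by rewrite !rmorphD !rmorphM /= map_polyX map_polyC hornerD hornerMX hornerC -IH.
Qed.

Implicit Types P : place (const_ext F).

Lemma in_ring_xpoly P g : in_ring P (xpoly 'X) -> in_ring P (xpoly g).
Proof.
move=> Rx; rewrite xpolyE horner_coef; apply: pge_sum => i _.
apply: (pgeM (n := 0) (n' := 0)); last exact: in_ringX.
by rewrite coef_map; exact: in_ring_const.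
Qed.

Lemma in_ring_xyeval P g : in_ring P (xpoly 'X) -> in_ring P y ->
  in_ring P (xyeval g).
Proof.
move=> Rx Ry; rewrite (xyeval_wide (leqnn _)); apply: pge_sum => i _.
by apply: (pgeM (n := 0) (n' := 0)); [exact: in_ring_xpoly | exact: in_ringX].
Qed.

(** Where x has a pole, the leading monomial dominates. *)
Lemma pval_xpoly_inf P (g : {poly k}) : P (xpoly 'X) < 0 -> g != 0 ->
  P (xpoly g) = P (xpoly 'X) * (size g).-1%:Z.
Proof.
move=> Px g0; have X0 : xpoly 'X != 0 by rewrite xpoly_eq0 polyX_eq0.
have T0 i : (const_ext F g`_i * xpoly 'X ^+ i != 0) = (g`_i != 0).
  by rewrite mulf_eq0 expf_eq0 (negPf X0) andbF orbF fmorph_eq0.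
have Tv i : g`_i != 0 -> P (const_ext F g`_i * xpoly 'X ^+ i) = P (xpoly 'X) * i%:Z.
  move=> gi; rewrite pvalM ?fmorph_eq0 ?expf_neq0 // pval_const add0r pvalX //.
  by rewrite -mulr_natr natz.
rewrite {1}xpolyE horner_coef size_map_poly.
under eq_bigr do rewrite coef_map /=.
rewrite -(big_mkord xpredT (fun i => const_ext F g`_i * xpoly 'X ^+ i)).
have dg : ((size g).-1 < size g)%N by rewrite prednK // size_poly_gt0.
have [||] := @pval_sum_distinct _ _ _ P _ (index_iota 0 (size g))
   (fun i => const_ext F g`_i * xpoly 'X ^+ i) (iota_uniq _ _).
- move=> i j _ _; rewrite !T0 => gi gj; rewrite !Tv //.
  by move/mulfI => /(_ (ltr0_neq0 Px)) [].
- apply/hasP; exists (size g).-1; rewrite ?mem_index_iota ?dg //.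
  by rewrite T0 -lead_coefE lead_coef_eq0.
move=> _ [i]; rewrite mem_index_iota => /andP[_ ig] [Ti -> imin]; move: Ti; rewrite T0 => gi.
have := imin (size g).-1; rewrite mem_index_iota dg => /(_ isT).
rewrite T0 -lead_coefE lead_coef_eq0 => /(_ g0).
rewrite !Tv ?ler_nM2l // -?lead_coefE ?lead_coef_eq0 // lez_nat => H.
by congr (_ * _%:Z); apply/eqP; rewrite eqn_leq H andbT -ltnS prednK // size_poly_gt0.
Qed.

End XY.

Arguments xyeval : simpl never.
Arguments xpoly : simpl never.

(** * The place at infinity *)

Definition curve_poly (k : fieldType) (f : {poly k}) (m : nat) : {poly {poly k}} :=
  'X^m - f%:P.

Lemma monic_curve_poly (k : fieldType) (f : {poly k}) m : (0 < m)%N ->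
  curve_poly f m \is monic.
Proof. by move=> m0; apply: monicXnsubC. Qed.

Lemma size_curve_poly (k : fieldType) (f : {poly k}) m : (0 < m)%N ->
  size (curve_poly f m) = m.+1.
Proof. by move=> m0; rewrite size_XnsubC. Qed.

(** Minus the order at infinity of a polynomial in x and y of degree less than m in y:
    y has order -r there, and x order -m. *)
Definition weight (k : fieldType) (m r : nat) (g : {poly {poly k}}) : nat :=
  \max_(i < m | g`_i != 0) (m * (size (g`_i)%R).-1 + r * i).

Section Curve.
Variables (k : fieldType) (F : fieldExtType {fraction {poly k}}) (y : F).
Variables (f : {poly k}) (m r : nat).
Hypotheses (m_gt0 : (0 < m)%N) (size_f : size f = r.+1) (coprime_mr : coprime m r).
Hypotheses (ym : y ^+ m = xpoly F f) (genF : <<1; y>>%VS = fullv).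

Local Notation S := {poly {poly k}}.
Local Notation x := (xpoly F 'X).
Implicit Types (P : place (const_ext F)) (g : S).

Lemma f_neq0 : f != 0.
Proof. by rewrite -size_poly_eq0 size_f. Qed.

Lemma y_neq0 : y != 0.
Proof.
apply: contraNneq f_neq0 => y0; rewrite -(xpoly_eq0 F) -ym y0.
by rewrite expf_eq0 m_gt0 eqxx.
Qed.

Lemma xyeval_curve : xyeval y (curve_poly f m) = 0.
Proof. by rewrite /curve_poly !xyevalE ym subrr. Qed.

Lemma xyeval_reduce g : exists2 g' : S, (size g' <= m)%N & xyeval y g' = xyeval y g.
Proof.
have mc := monic_curve_poly f m_gt0.
exists (Pdiv.Ring.rmodp g (curve_poly f m)).
  rewrite -ltnS -(size_curve_poly f m_gt0).
  by apply: Pdiv.Ring.ltn_rmodpN0; rewrite monic_neq0.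
rewrite [in RHS](Pdiv.RingMonic.rdivp_eq mc g).
by rewrite xyevalD xyevalM xyeval_curve mulr0 add0r.
Qed.

Lemma xyeval_frac (z : F) : exists g N,
  [/\ (size g <= m)%N, N != 0 & z * xpoly F N = xyeval y g].
Proof.
have /Fadjoin1_polyP[q ->] : z \in <<1; y>>%VS by rewrite genF memvf.
have [g [N [N0 E]]] := poly_fracP q.
have [g' gm Eg] := xyeval_reduce g; exists g', N; split => //.
rewrite Eg /xyeval -[map_poly _ g]/(map_poly (in_alg F \o @tofrac {poly k}) g)
  map_poly_comp E map_polyZ hornerZ mulrC.
by [].
Qed.

Section Infinity.
Variable P : place (const_ext F).
Hypothesis Px : P x < 0.

(** The relation m P(y) = r P(x) and coprimality make both orders multiples of
    one e. *)
Lemma pval_y_inf : exists2 e : nat, (0 < e)%N &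
  P x = - (m * e)%:Z /\ P y = - (r * e)%:Z.
Proof.
have E : P y * m%:Z = P x * r%:Z.
  have := pval_xpoly_inf Px f_neq0; rewrite size_f -ym pvalX ?y_neq0 // -[r.+1.-1]/r.
  by rewrite -mulr_natr natz.
have [s Es] : exists s : nat, P x = - s%:Z.
  by exists `|P x|%N; lia.
have s0 : (0 < s)%N by lia.
have [t Et] : exists t : nat, P y = - t%:Z by exists `|P y|%N; nia.
have E' : (t * m = s * r)%N by nia.
have : (m %| s)%N by rewrite -(Gauss_dvdl _ coprime_mr) -E' dvdn_mull.
case/dvdnP=> e Ee; exists e; first by nia.
split; [nia | rewrite Et; congr (- _); congr Posz]; nia.
Qed.

(** The terms g_i y^i have orders that are incongruent modulo e m, since r is
    prime to m; hence they do not cancel. *)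
Lemma pval_xyeval_inf e g : (0 < e)%N -> P x = - (m * e)%:Z -> P y = - (r * e)%:Z ->
  (size g <= m)%N -> g != 0 ->
  xyeval y g != 0 /\ P (xyeval y g) = - (e * weight m r g)%:Z.
Proof.
move=> e0 Ex Ey gm g0.
pose T (i : 'I_m) := xpoly F g`_i * y ^+ i.
have T0 (i : 'I_m) : (T i != 0) = (g`_i != 0).
  by rewrite mulf_eq0 expf_eq0 (negPf y_neq0) andbF orbF xpoly_eq0.
have Tv (i : 'I_m) : g`_i != 0 -> P (T i) = - (e * (m * (size (g`_i)%R).-1 + r * i))%:Z.
  move=> gi; rewrite pvalM ?xpoly_eq0 ?expf_neq0 ?y_neq0 // pval_xpoly_inf //.
  by rewrite pvalX ?y_neq0 // Ex Ey -mulr_natr natz; lia.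
rewrite (xyeval_wide _ gm).
have [||A [i _ [Ti Pi imin]]] := @pval_sum_distinct _ _ _ P _ (index_enum 'I_m)
   T (index_enum_uniq _).
- move=> i j _ _; rewrite !T0 => gi gj; rewrite !Tv // => H; apply: val_inj => /=.
  have {}H : (m * (size (g`_i)%R).-1 + r * i = m * (size (g`_j)%R).-1 + r * j)%N by nia.
  wlog ij : i j gi gj H / (i <= j)%N.
    by move=> W; case/orP: (leq_total i j) => ij; [apply: W|symmetry; apply: W].
  have D : (m %| r * (j - i))%N.
    have E : (m * (size (g`_i)%R).-1 = m * (size (g`_j)%R).-1 + r * (j - i))%N by nia.
    by rewrite -(@dvdn_addr (m * (size (g`_j)%R).-1) m) ?dvdn_mulr // -E dvdn_mulr.
  rewrite Gauss_dvdr // in D.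
  have jm := ltn_ord j; case: (posnP (j - i)) => [|p]; first by lia.
  by have := dvdn_leq p D; lia.
- have dm : ((size g).-1 < m)%N.
    by apply: leq_trans gm; rewrite prednK // size_poly_gt0.
  apply/hasP; exists (Ordinal dm); first by rewrite mem_index_enum.
  by rewrite T0 /= -lead_coefE lead_coef_eq0.
split=> //; rewrite [LHS]Pi; rewrite T0 in Ti; rewrite Tv //; congr (- _%:Z); congr (e * _)%N.
apply/eqP; rewrite eqn_leq; apply/andP; split.
  exact: (@leq_bigmax_cond _ (fun i : 'I_m => g`_i != 0) (fun i : 'I_m => m * (size (g`_i)%R).-1 + r * i)%N i Ti).
apply/bigmax_leqP => j gj; have := imin j (mem_index_enum _).
by rewrite T0 => /(_ gj); rewrite !Tv //; nia.
Qed.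

Lemma xyeval_inj g : (size g <= m)%N -> xyeval y g = 0 -> g = 0.
Proof.
move=> gm E; apply/eqP; apply: contraT => g0.
have [e e0 [Ex Ey]] := pval_y_inf.
by have [] := pval_xyeval_inf e0 Ex Ey gm g0; rewrite E eqxx.
Qed.

(** All orders are multiples of e, and a uniformizer has order 1. *)
Lemma pval_x_inf : P x = - m%:Z /\ P y = - r%:Z.
Proof.
have [e e0 [Ex Ey]] := pval_y_inf.
suff e1 : e = 1%N by rewrite Ex Ey e1 !muln1.
have [t Pt] := pval_uniformizer P.
have t0 : t != 0 by apply: contra_eqN Pt => /eqP->; rewrite pval0.
have [g [N [gm N0 E]]] := xyeval_frac t.
have g0 : g != 0.
  apply: contra_neqN N0 => /eqP g0; apply/eqP; rewrite -(xpoly_eq0 F).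
  by move: E; rewrite g0 rmorph0 => /eqP; rewrite mulf_eq0 (negPf t0).
have [_ W] := pval_xyeval_inf e0 Ex Ey gm g0.
move: W; rewrite -E pvalM ?xpoly_eq0 // Pt pval_xpoly_inf // Ex => W.
have : (e %| 1)%N.
  apply/dvdnP; exists (m * (size N).-1 - weight m r g)%N.
  by rewrite mulnBl; nia.
by rewrite dvdn1 => /eqP.
Qed.

Lemma pval_inf g : (size g <= m)%N -> g != 0 -> P (xyeval y g) = - (weight m r g)%:Z.
Proof.
have [Ex Ey] := pval_x_inf; move=> gm g0.
by have [|||_ ->] := @pval_xyeval_inf 1 g _ _ _ gm g0; rewrite ?muln1 ?mul1n.
Qed.

Lemma xyeval_kernel g : xyeval y g = 0 -> exists q, g = q * curve_poly f m.
Proof.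
have mc := monic_curve_poly f m_gt0.
move=> E; apply/(Pdiv.RingMonic.rdvdpP mc); rewrite /Pdiv.Ring.rdvdp; apply/eqP.
apply: xyeval_inj.
  rewrite -ltnS -(size_curve_poly f m_gt0).
  by apply: Pdiv.Ring.ltn_rmodpN0; rewrite monic_neq0.
move: E; rewrite [in X in X -> _](Pdiv.RingMonic.rdivp_eq mc g).
by rewrite xyevalD xyevalM xyeval_curve mulr0 add0r.
Qed.

(** A relation of degree less than m would contradict xyeval_inj. *)
Lemma dim_curve : \dim {:F} = m.
Proof.
rewrite -genF; have -> : \dim <<1; y>>%VS = adjoin_degree 1 y.
  by rewrite adjoin_degreeE dimv1 divn1.
apply/eqP; rewrite eqn_leq; apply/andP; split.
  have p0 : 'X^m - (xpoly F f)%:P != 0 by rewrite monic_neq0 // monicXnsubC.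
  rewrite -ltnS -size_minPoly -(size_XnsubC (xpoly F f) m_gt0); apply: dvdp_leq => //.
  apply: minPoly_dvdp; last by rewrite /root !hornerE ym subrr.
  rewrite rpredB ?rpredX ?polyOverX ?polyOverC //.
  by apply/vlineP; exists (tofrac f).
have /polyOver1P[q Eq] := minPolyOver 1 y.
rewrite leqNgt; apply/negP => dm.
have [g [N [N0 E]]] := poly_fracP q.
have N0' : (tofrac N : {fraction {poly k}}) != 0 by rewrite tofrac_eq0.
have sg : size g = (adjoin_degree 1 y).+1.
  rewrite -(size_minPoly 1 y) Eq size_map_poly -(size_scale q N0') -E size_map_inj_poly //.
  by move=> u v /eqP; rewrite tofrac_eq => /eqP.
have g0 : g = 0.
  apply: xyeval_inj; first by rewrite sg.
  rewrite /xyeval -[map_poly _ g]/(map_poly (in_alg F \o @tofrac {poly k}) g)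
    map_poly_comp E map_polyZ hornerZ /= -[map_poly _ _]/(map_poly (in_alg F) q).
  by rewrite -Eq minPolyxx mulr0.
by move: sg; rewrite g0 size_poly0.
Qed.

End Infinity.

(** The formula for the order at infinity does not depend on the place. *)
Lemma inf_unique P P' : P x < 0 -> P' x < 0 -> P = P'.
Proof.
move=> Px Px'; apply: place_eq => z z0.
have [g [N [gm N0 E]]] := xyeval_frac z.
have g0 : g != 0.
  apply: contra_neqN N0 => /eqP g0; apply/eqP; rewrite -(xpoly_eq0 F).
  by move: E; rewrite g0 rmorph0 => /eqP; rewrite mulf_eq0 (negPf z0).
have H (R : place (const_ext F)) : R x < 0 ->
    R z = m%:Z * (size N).-1%:Z - (weight m r g)%:Z.
  move=> Rx; have := pval_inf Rx gm g0.
  rewrite -E pvalM ?xpoly_eq0 // pval_xpoly_inf //.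
  by have [-> _] := pval_x_inf Rx; lia.
by rewrite !H.
Qed.

End Curve.

(** * Places from locally principal primes *)

(** M plays the part of a prime ideal of k[x, y], and t generates it locally: a
    multiplier off M turns any element of M into a multiple of t.  The condition
    lp_order, on polynomials in x alone, is what makes every order finite. *)
Record local_prime (k : fieldType) (F : fieldExtType {fraction {poly k}}) (y : F)
    (M : pred {poly {poly k}}) (t : {poly {poly k}}) : Prop := LocalPrime {
  lp_proper : ~~ M 1;
  lp_prime : forall g h, M (g * h) = M g || M h;
  lp_add : forall g h, M g -> M h -> M (g + h);
  lp_kernel : forall g, xyeval y g = 0 -> M g;
  lp_unif : M t;
  lp_unif_neq0 : xyeval y t != 0;
  lp_principal : forall g, M g ->
    exists h g', ~~ M h /\ xyeval y (h * g) = xyeval y (t * g');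
  lp_order : forall N : {poly k}, N != 0 ->
    exists s h e, [/\ ~~ M h, ~~ M e & xyeval y (h * N%:P) = xyeval y (t ^+ s * e)]
}.

Lemma min_diff (a b : int) : (exists d : nat, a = Num.min a b + d%:Z) /\
  (exists d : nat, b = Num.min a b + d%:Z).
Proof.
by split; [exists `|a - Num.min a b|%N | exists `|b - Num.min a b|%N]; case: leP; lia.
Qed.

Section Local.
Variables (k : fieldType) (F : fieldExtType {fraction {poly k}}) (y : F).
Hypothesis fracF : forall z : F, exists (g : {poly {poly k}}) (N : {poly k}),
  N != 0 /\ z * xpoly F N = xyeval y g.
Variables (M : pred {poly {poly k}}) (t : {poly {poly k}}).
Hypothesis LP : local_prime y M t.

Local Notation S := {poly {poly k}}.
Local Notation Phi := (xyeval y).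
Implicit Types (g h e w : S) (z : F) (n : int).

Lemma lpN g : M (- g) = M g.
Proof.
have M1 : ~~ M (-1).
  apply: contra (lp_proper LP) => M1.
  by rewrite -[1]mulr1 -mulrNN (lp_prime LP) M1.
by rewrite -mulN1r (lp_prime LP) (negPf M1).
Qed.

Lemma lp_congr g h : Phi g = Phi h -> M g = M h.
Proof.
suff H g' h' : Phi g' = Phi h' -> M g' -> M h'.
  by move=> E; apply/idP/idP; apply: H.
move=> E Mg; rewrite -[h'](subKr g'); apply: (lp_add LP) => //; rewrite lpN.
by apply: (lp_kernel LP); rewrite xyevalB E subrr.
Qed.

Lemma lp_neq0 g : ~~ M g -> Phi g != 0.
Proof. by apply: contra => /eqP; apply: (lp_kernel LP). Qed.

Lemma lpX (n : nat) g : M (g ^+ n.+1) = M g.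
Proof. by elim: n => // n IH; rewrite exprS (lp_prime LP) IH orbb. Qed.

(** Dividing by the uniformizer terminates because a multiple of g is a
    polynomial in x, whose order is finite. *)
Lemma lp_order_xyeval g : Phi g != 0 ->
  exists s h e, [/\ ~~ M h, ~~ M e & Phi (h * g) = Phi (t ^+ s * e)].
Proof.
move=> g0; have [w [N [N0 Ew]]] := fracF (Phi g)^-1.
have [s [h [e [Mh Me E]]]] := lp_order LP N0.
have {E} : Phi ((h * w) * g) = Phi (t ^+ s * e).
  by rewrite -E !xyevalM -Ew xyevalC -mulrA [_^-1 * _]mulrC mulfVK.
move: (h * w) => {N N0 Ew h Mh} {}w.
elim: s g g0 w e Me => [|s IH] g g0 w e Me E.
  exists 0%N, 1, g; rewrite (lp_proper LP) expr0 !mul1r; split=> //.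
  apply: contra Me => Mg; rewrite expr0 mul1r in E.
  by rewrite -(lp_congr E) (lp_prime LP) Mg orbT.
case: (boolP (M g)) => [Mg|Mg]; last first.
  by exists 0%N, 1, g; rewrite (lp_proper LP) expr0 !mul1r.
have [h1 [g1 [Mh1 E1]]] := lp_principal LP Mg.
have h10 := lp_neq0 Mh1; have t0 := lp_unif_neq0 LP.
have g10 : Phi g1 != 0.
  apply: contra_neq (mulf_neq0 h10 g0) => g10.
  by rewrite -xyevalM E1 xyevalM g10 mulr0.
have [||s' [h [e' [Mh Me' E']]]] := IH g1 g10 w (h1 * e).
- by rewrite (lp_prime LP) (negPf Mh1).
- apply: (mulfI t0); transitivity (Phi w * (Phi (t * g1))); first by rewrite !xyevalM mulrCA.
  rewrite -E1 xyevalM mulrCA -xyevalM E -!xyevalM exprS; congr (Phi _); ring.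
exists s'.+1, (h * h1), e'; split=> //; first by rewrite (lp_prime LP) (negPf Mh).
by rewrite -mulrA xyevalM E1 xyevalM mulrCA -xyevalM E' -xyevalM exprS mulrA.
Qed.

Lemma local_decomp z : z != 0 -> exists n g h,
  [/\ ~~ M g, ~~ M h & z * Phi h = Phi t ^ n * Phi g].
Proof.
move=> z0; have [g [N [N0 E]]] := fracF z.
have N0' : xpoly F N != 0 by rewrite xpoly_eq0.
have g0 : Phi g != 0 by rewrite -E mulf_neq0.
have [s [h [e [Mh Me Eg]]]] := lp_order_xyeval g0.
have [s' [h' [e' [Mh' Me' EN]]]] := lp_order LP N0.
exists (s%:Z - s'%:Z), (h' * e), (h * e'); rewrite !(lp_prime LP) (negPf Mh) (negPf Mh').
split=> //; have t0 := lp_unif_neq0 LP; rewrite expfzDr // -exprnP -invr_expz -exprnP.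
have T0 : Phi t ^+ s' != 0 by rewrite expf_neq0.
have {}Eg : Phi h * Phi g = Phi t ^+ s * Phi e by rewrite -!xyevalM Eg xyevalM xyeval_exp.
have {}EN : Phi h' * xpoly F N = Phi t ^+ s' * Phi e'.
  by rewrite -(xyevalC y) -xyevalM EN xyevalM xyeval_exp.
have -> : Phi (h * e') = Phi h * Phi e' by rewrite xyevalM.
have -> : Phi (h' * e) = Phi h' * Phi e by rewrite xyevalM.
move: (Phi g) (Phi h) (Phi e) (Phi h') (Phi e') (Phi t ^+ s) (Phi t ^+ s') (xpoly F N)
  T0 N0' Eg EN E => G H A H' A' T T' X T0 X0 Eg EN E.
apply: (mulIf T0); apply: (mulIf X0).
transitivity (z * X * (H * (T' * A'))); first by ring.
rewrite -EN E; transitivity (H * G * (H' * X)); first by ring.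
by rewrite Eg; field.
Qed.

(** Were n > n', the product g' h would be a multiple of t, hence in M. *)
Lemma local_rep_le z n g h n' g' h' :
  ~~ M h -> z * Phi h = Phi t ^ n * Phi g ->
  ~~ M g' -> z * Phi h' = Phi t ^ n' * Phi g' -> n <= n'.
Proof.
move=> Mh E Mg' E'; rewrite leNgt; apply/negP => lt_n.
have t0 := lp_unif_neq0 LP.
have [d Ed] : exists d : nat, n = n' + d.+1%:Z by exists `|n - n'|.-1%N; lia.
have : Phi (g' * h) = Phi (t ^+ d.+1 * (g * h')).
  rewrite !xyevalM xyeval_exp; apply: (mulfI (expfz_neq0 n' t0)).
  transitivity (z * Phi h' * Phi h); first by rewrite E' mulrA.
  transitivity (z * Phi h * Phi h'); first by rewrite mulrAC.
  by rewrite E Ed expfzDr // -exprnP; ring.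
move/lp_congr; rewrite !(lp_prime LP) !lpX (lp_unif LP) (negPf Mg') (negPf Mh).
by [].
Qed.

(** Every nonzero z is t^n g/h with g and h off M, and n is unique by
    local_rep_le; it is the value of z. *)
Lemma local_place : exists P : place (const_ext F),
  (forall g, ~~ M g -> P (Phi g) = 0) /\ P (Phi t) = 1.
Proof.
have t0 := lp_unif_neq0 LP.
have /choice[v Hv] z : exists n, z != 0 -> exists g h,
    [/\ ~~ M g, ~~ M h & z * Phi h = Phi t ^ n * Phi g].
  have [->|z0] := eqVneq z 0; first by exists 0.
  by have [n [g [h H]]] := local_decomp z0; exists n => _; exists g, h.
pose w z := if z == 0 then 0 else v z.
have Hw z : z != 0 -> exists g h, [/\ ~~ M g, ~~ M h & z * Phi h = Phi t ^ w z * Phi g].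
  by move=> z0; rewrite /w (negPf z0); apply: Hv.
have weq z n g h : z != 0 -> ~~ M g -> ~~ M h -> z * Phi h = Phi t ^ n * Phi g -> w z = n.
  move=> z0 Mg Mh E; have [g' [h' [Mg' Mh' E']]] := Hw z z0.
  by apply/eqP; rewrite eq_le (local_rep_le Mh E Mg' E') (local_rep_le Mh' E' Mg E).
have wge z n g h : z != 0 -> ~~ M h -> z * Phi h = Phi t ^ n * Phi g -> n <= w z.
  move=> z0 Mh E; have [g' [h' [Mg' Mh' E']]] := Hw z z0.
  exact: (local_rep_le Mh E Mg' E').
have wunit g : ~~ M g -> w (Phi g) = 0.
  move=> Mg; apply: (weq _ _ g 1) => //; rewrite ?lp_neq0 ?(lp_proper LP) //.
  by rewrite rmorph1 mulr1 expr0z mul1r.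
have wt : w (Phi t) = 1.
  apply: (weq _ _ 1 1) => //; rewrite ?(lp_proper LP) //.
have w0 : w 0 = 0 by rewrite /w eqxx.
have wconst c : w (const_ext F c) = 0.
  have [->|c0] := eqVneq c 0; first by rewrite rmorph0.
  rewrite -xpolyC -(xyevalC y); apply: wunit; apply: contra (lp_proper LP) => Mc.
  have -> : 1 = (c^-1)%:P%:P * c%:P%:P :> S by rewrite -!rmorphM mulVf.
  by rewrite (lp_prime LP) Mc orbT.
have wM z z' : z != 0 -> z' != 0 -> w (z * z') = w z + w z'.
  move=> z0 z'0; have [g [h [Mg Mh E]]] := Hw z z0.
  have [g' [h' [Mg' Mh' E']]] := Hw z' z'0.
  apply: (weq _ _ (g * g') (h * h')).
  - by rewrite mulf_neq0.
  - by rewrite (lp_prime LP) negb_or Mg.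
  - by rewrite (lp_prime LP) negb_or Mh.
  - by rewrite !xyevalM mulrACA E E' expfzDr // mulrACA.
have wD z z' : z != 0 -> z' != 0 -> z + z' != 0 -> Num.min (w z) (w z') <= w (z + z').
  move=> z0 z'0 s0; have [g [h [Mg Mh E]]] := Hw z z0.
  have [g' [h' [Mg' Mh' E']]] := Hw z' z'0.
  have [[d Ed] [d' Ed']] := min_diff (w z) (w z'); set l := Num.min _ _ in Ed Ed' *.
  apply: (wge _ _ (t ^+ d * g * h' + t ^+ d' * g' * h) (h * h')) => //.
    by rewrite (lp_prime LP) negb_or Mh.
  rewrite xyevalD !xyevalM !xyeval_exp mulrDl.
  rewrite (mulrA z) E (mulrCA z') E' Ed Ed' !expfzDr // -!exprnP.
  move: (Phi t ^ l) (Phi t ^+ d) (Phi t ^+ d') (Phi g) (Phi h) (Phi g') (Phi h').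
  by move=> *; ring.
by exists (Place w0 wconst wM wD (ex_intro _ _ wt)).
Qed.

Section Units.
Variable P : place (const_ext F).
Hypotheses (Punit : forall g, ~~ M g -> P (Phi g) = 0) (Pt : in_ideal P (Phi t)).

Lemma pval_local z n g h : ~~ M g -> ~~ M h -> z * Phi h = Phi t ^ n * Phi g ->
  P z = P (Phi t) * n.
Proof.
move=> Mg Mh E; have t0 := lp_unif_neq0 LP.
have z0 : z != 0.
  have : z * Phi h != 0 by rewrite E mulf_neq0 ?expfz_neq0 // lp_neq0.
  by rewrite mulf_eq0 negb_or => /andP[].
have := pvalM P z0 (lp_neq0 Mh); rewrite E pvalM ?(expfz_neq0 _ t0) ?(lp_neq0 Mg) //.
by rewrite (Punit Mg) (Punit Mh) !addr0 pval_exprz.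
Qed.

(** All values are multiples of the value of t, and 1 is one of them. *)
Lemma pval_local_unif : P (Phi t) = 1.
Proof.
have t0 := lp_unif_neq0 LP; have := Pt; rewrite /in_ideal (negPf t0) /= => Pt0.
have [u Pu] := pval_uniformizer P.
have u0 : u != 0 by apply: contra_eqN Pu => /eqP->; rewrite pval0.
have [n [g [h [Mg Mh E]]]] := local_decomp u0.
have := pval_local Mg Mh E; rewrite Pu => /(congr1 absz); rewrite abszM => /esym/eqP.
by rewrite muln_eq1 => /andP[/eqP Pt1 _]; rewrite -(gtz0_abs Pt0) Pt1.
Qed.

End Units.

Lemma local_place_unique (P P' : place (const_ext F)) :
  (forall g, ~~ M g -> P (Phi g) = 0) -> in_ideal P (Phi t) ->
  (forall g, ~~ M g -> P' (Phi g) = 0) -> in_ideal P' (Phi t) -> P = P'.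
Proof.
move=> U T U' T'; apply: place_eq => z z0.
have [n [g [h [Mg Mh E]]]] := local_decomp z0.
by rewrite (pval_local U Mg Mh E) (pval_local U' Mg Mh E) !pval_local_unif.
Qed.

(** In z = t^n g/h the exponent n is not negative, so t^n can join the numerator. *)
Lemma local_ring (P : place (const_ext F)) z : in_ring P z ->
  (forall g, ~~ M g -> P (Phi g) = 0) -> in_ideal P (Phi t) ->
  exists g h, ~~ M h /\ z * Phi h = Phi g.
Proof.
move=> Rz U T; have [->|z0] := eqVneq z 0.
  by exists 0, 1; rewrite (lp_proper LP) mul0r rmorph0.
have [n [g [h [Mg Mh E]]]] := local_decomp z0.
move: Rz; rewrite /in_ring (negPf z0) (pval_local U Mg Mh E) pval_local_unif // mul1r.
case: n E => // n E _; exists (t ^+ n * g), h; split=> //.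
by rewrite E xyevalM xyeval_exp.
Qed.

End Local.

(** * Factors of polynomials *)

Section Irreducible.
Variable k : fieldType.
Implicit Types (p q g h N : {poly k}).

Lemma irreducible_dvdM p g h : irreducible_poly p ->
  (p %| g * h) = (p %| g) || (p %| h).
Proof.
move=> ip; have [pg|npg] /= := boolP (p %| g); first by rewrite dvdp_mulr.
by rewrite Gauss_dvdpr // irreducible_poly_coprime.
Qed.

Lemma irreducible_ndvd1 p : irreducible_poly p -> ~~ (p %| 1).
Proof.
by move=> [p1 _]; rewrite dvdp1 neq_ltn p1 orbT.
Qed.

Lemma factor_out p N : irreducible_poly p -> N != 0 ->
  exists s N', N = p ^+ s * N' /\ ~~ (p %| N').
Proof.
move=> ip; have p0 := irredp_neq0 ip.
have [n] := ubnP (size N); elim: n N => // n IH N sN N0.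
have [/dvdpP[q Eq]|npN] := boolP (p %| N); last first.
  by exists 0%N, N; rewrite expr0 mul1r.
have q0 : q != 0 by apply: contraNneq N0 => q0; rewrite Eq q0 mul0r.
have [|s [N' [E ND]]] := IH q _ q0.
  have [sp _] := ip; have sq : (0 < size q)%N by rewrite size_poly_gt0.
  by move: sN sp sq; rewrite Eq size_mul //; move: (size q) (size p); lia.
by exists s.+1, N'; rewrite Eq E exprS; split=> //; ring.
Qed.

Lemma irreducible_factor q : (1 < size q)%N ->
  exists2 h, irreducible_poly h & h %| q.
Proof.
have [n] := ubnP (size q); elim: n q => // n IH q sq q1.
have [iq|niq] := pselect (irreducible_poly q); first by exists q.
have [d [d1 dq ndq]] : exists d : {poly k}, [/\ size d != 1%N, d %| q & ~~ (d %= q)].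
  apply: contra_notP niq => H; split=> // d d1 dq.
  by apply: contra_notT H => ndq; exists d.
have q0 : q != 0 by rewrite -size_poly_eq0; lia.
have d0 : d != 0 by apply: contraNneq q0 => d0; rewrite -dvd0p -d0.
have lt_dq : (size d < size q)%N.
  by rewrite ltn_neqAle (dvdp_leq q0 dq) andbT; apply: contra ndq => E; rewrite -dvdp_size_eqp.
have [||h ih hd] := IH d.
- by apply: leq_trans lt_dq _; rewrite -ltnS.
- by move: d1; rewrite -(size_poly_gt0 d) in d0; lia.
by exists h => //; apply: dvdp_trans dq.
Qed.

(** Membership passes from q to a factor of smaller degree until an irreducible
    one is reached. *)
Lemma irreducible_factor_in (I : pred {poly k}) q :
  (forall g h, I (g * h) -> I g || I h) -> (forall c, I c%:P -> c = 0) ->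
  q != 0 -> I q -> exists h, [/\ irreducible_poly h, h %| q & I h].
Proof.
move=> IM IC; have [n] := ubnP (size q); elim: n q => // n IH q qn q0 Iq.
have q1 : (1 < size q)%N.
  rewrite ltnNge; apply: contra q0 => /size1_polyC Eq.
  by move: Iq; rewrite Eq => /IC ->.
have [h ih /dvdpP[q' Eq]] := irreducible_factor q1.
move: Iq; rewrite Eq => /IM/orP[Iq'|Ih]; last by exists h; rewrite dvdp_mull.
have q'0 : q' != 0 by apply: contraNneq q0 => E; rewrite Eq E mul0r.
have [||h' [ih' hq' Ih']] := IH q' _ q'0 => //.
  have [sh _] := ih; move: (q'0) qn sh; rewrite -size_poly_gt0 Eq size_mul ?(irredp_neq0 ih) //.
  by move: (size q') (size h); lia.
by exists h'; rewrite dvdp_mulr.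
Qed.

Lemma coprime_prod_dvd (I : eqType) (s : seq I) (h : I -> {poly k}) q :
  uniq s -> {in s &, forall i j, i != j -> coprimep (h i) (h j)} ->
  {in s, forall i, h i %| q} -> \prod_(i <- s) h i %| q.
Proof.
elim: s => [|i s IH] /=; first by rewrite big_nil dvd1p.
move=> /andP[iNs us] cop hq; rewrite big_cons Gauss_dvdp.
  rewrite hq ?mem_head // IH // => [u v us' vs|u us'].
    by apply: cop; rewrite inE ?us' ?vs orbT.
  by apply: hq; rewrite inE us' orbT.
rewrite big_seq; elim/big_ind: _ => [|a b Ha Hb|j js]; first exact: coprimep1.
  by rewrite coprimepMr Ha.
apply: cop; rewrite ?mem_head // ?inE ?js ?orbT //.
by apply: contraNneq iNs => ->.
Qed.

(** The quotient of k[x] by p, given by its projection: the surjectivity serves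
    to lift factorizations modulo p back to k[x]. *)
Lemma residue_field p : irreducible_poly p ->
  exists (K : fieldType) (rho : {rmorphism {poly k} -> K}),
    (forall c, exists g, rho g = c) /\ (forall g, rho g = 0 <-> p %| g).
Proof.
move=> ip; have p0 := irredp_neq0 ip.
have lp0 : (lead_coef p)^-1 != 0 by rewrite invr_eq0 lead_coef_eq0.
pose h := (lead_coef p)^-1 *: p.
have hp : h %= p by rewrite eqp_scale.
have hm : h \is monic by rewrite monicE lead_coefZ mulVf // lead_coef_eq0.
have hi : irreducible_poly h.
  split; first by rewrite size_scale //; case: ip.
  move=> d d1 dh; rewrite (eqp_trans (ip.2 d d1 _)) // ?(eqp_dvdr _ hp) //.
    by rewrite -(eqp_dvdr _ hp).
  by rewrite eqp_sym.
have hI : monic_irreducible_poly h by split.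
pose rho0 : {rmorphism {poly k} -> {poly %/ h}} := in_qpoly h.
exists {poly %/ h with hI}, rho0; split=> [c|g].
  exists (val (c : {poly %/ h})); apply: val_inj; apply: in_qpoly_small.
  exact: size_mk_monic.
rewrite -(eqp_dvdl _ hp); split=> [/(congr1 val) /= |] E.
  by rewrite dvdpE; apply/eqP; rewrite -(mk_monicE hI).
by apply: val_inj => /=; rewrite mk_monicE //; apply/eqP; rewrite -[_ == _]dvdpE.
Qed.

(** The part of c prime to b is not constant for reasons of degree, and by
    separability its factors are not shared with gcd(c, b). *)
Lemma separable_factor_ndvd (c b : {poly k}) : separable_poly c -> b != 0 ->
  (size b < size c)%N -> exists h, [/\ irreducible_poly h, h %| c & ~~ (h %| b)].
Proof.
move=> sc b0 bc; have c0 : c != 0 by rewrite -size_poly_gt0; lia.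
have /dvdpP[q Eq] := dvdp_gcdl c b; set d := gcdp c b in Eq.
have d0 : d != 0 by rewrite gcdp_eq0 negb_and b0 orbT.
have q0 : q != 0 by apply: contraNneq c0 => q0; rewrite Eq q0 mul0r.
have q1 : (1 < size q)%N.
  have db : (size d <= size b)%N := dvdp_leq b0 (dvdp_gcdr c b).
  have [sq sd] : (0 < size q)%N /\ (0 < size d)%N by rewrite !size_poly_gt0.
  by move: bc db sq sd; rewrite Eq size_mul //; move: (size q) (size d) (size b); lia.
have [h ih hq] := irreducible_factor q1.
exists h; split=> //; first by rewrite Eq dvdp_mulr.
apply/negP => hb; have hd : h %| d by rewrite dvdp_gcd hb andbT Eq dvdp_mulr.
have := separable_coprime sc (_ : q * d %| c); rewrite -Eq => /(_ (dvdpp _)).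
move/coprimepP => /(_ h hq hd); rewrite -size_poly_eq1 => /eqP sh.
by case: ih; rewrite sh.
Qed.

(** X (X^m - c)' and m (X^m - c) differ by the nonzero constant m c. *)
Lemma separable_Xn_sub (c : k) m : (0 < m)%N -> (m%:R : k) != 0 -> c != 0 ->
  separable_poly ('X^m - c%:P).
Proof.
move=> m0 mk c0; rewrite unlock derivB derivXn derivC subr0.
apply/coprimepP => d d1 d2.
suff : d %| (m%:R * c)%:P.
  move=> dc; rewrite -size_poly_eq1 eqn_leq size_poly_gt0.
  have mc0 : (m%:R * c)%:P != 0 :> {poly k} by rewrite polyC_eq0 mulf_neq0.
  rewrite (leq_trans (dvdp_leq mc0 dc) (size_polyC_leq1 _)) /=.
  by apply: contraNneq mc0 => d0; rewrite -dvd0p -d0.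
have -> : (m%:R * c)%:P = 'X * ('X^(m.-1) *+ m) - (m%:R : k)%:P * ('X^m - c%:P).
  by rewrite mulrnAr -exprS prednK // -mulr_natl !polyCM polyC_natr; ring.
by rewrite dvdp_sub ?dvdp_mull.
Qed.

End Irreducible.

Lemma map_poly_surj (R K : nzRingType) (rho : {rmorphism R -> K}) :
  (forall c, exists g, rho g = c) -> forall q, exists g, map_poly rho g = q.
Proof.
move=> H q; elim/poly_ind: q => [|q c [g Eg]]; first by exists 0; rewrite rmorph0.
have [u Eu] := H c; exists (g * 'X + u%:P).
by rewrite rmorphD rmorphM /= map_polyX map_polyC Eg /= Eu.
Qed.

Lemma polyC_dvd_coef (k : fieldType) (p : {poly k}) (u : {poly {poly k}}) :
  p != 0 -> (forall i, p %| u`_i) -> exists v, u = p%:P * v.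
Proof.
move=> p0 pu; exists (\poly_(i < size u) (u`_i %/ p)).
apply/polyP => i; rewrite coefCM coef_poly; case: ltnP => iu; last first.
  by rewrite mulr0 nth_default.
by rewrite mulrC divpK.
Qed.

(** * The local primes of the curve *)

Section CurvePlaces.
Variables (k : fieldType) (F : fieldExtType {fraction {poly k}}) (y : F).
Variables (f : {poly k}) (m : nat).
Hypotheses (m_gt0 : (0 < m)%N) (f0 : f != 0) (ym : y ^+ m = xpoly F f).
Hypothesis kerF : forall g, xyeval y g = 0 -> exists q, g = q * curve_poly f m.
Hypothesis fracF : forall z : F, exists (g : {poly {poly k}}) (N : {poly k}),
  N != 0 /\ z * xpoly F N = xyeval y g.

Local Notation S := {poly {poly k}}.
Local Notation x := (xpoly F 'X).
Local Notation Phi := (xyeval y).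
Implicit Types (P : place (const_ext F)) (g : S).

Lemma curve_y_neq0 : y != 0.
Proof.
apply: contraNneq f0 => y_eq0; rewrite -(xpoly_eq0 F) -ym y_eq0.
by rewrite expf_eq0 m_gt0 eqxx.
Qed.

Local Notation y0 := curve_y_neq0.

(** With f = p w the equation reads p w = y^m, so that p is a multiple of y up to
    the multiplier w, which is off the prime. *)
Lemma ramified_local_prime p w : irreducible_poly p -> f = p * w -> ~~ (p %| w) ->
  local_prime y (fun g => p %| g`_0) 'X.
Proof.
move=> ip Ef npw; split.
- by rewrite coef1 irreducible_ndvd1.
- by move=> g h; rewrite coef0M irreducible_dvdM.
- by move=> g h; rewrite coefD; apply: dvdp_add.
- move=> g /kerF[q ->]; rewrite coef0M coefB coefXn coefC eqxx.
  by rewrite (ltn_eqF m_gt0) sub0r Ef dvdp_mull // dvdpNr dvdp_mulr.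
- by rewrite coefX dvdp0.
- by rewrite xyevalX y0.
- move=> g; elim/poly_ind: g => [|g2 c _] /=.
    by exists 1, 0; rewrite coef1 irreducible_ndvd1 // !mulr0.
  rewrite coefD coefMX coefC /= add0r => /dvdpP[s Ec].
  exists w%:P, (w%:P * g2 + s%:P * 'X^(m.-1)); split; first by rewrite coefC.
  have E : xpoly F w * xpoly F c = xpoly F s * xpoly F f.
    by rewrite -!rmorphM Ec Ef; congr (xpoly F _); ring.
  have Y : y * y ^+ m.-1 = xpoly F f by rewrite -exprS prednK.
  rewrite !xyevalE mulrDr E -Y.
  by move: (y ^+ m.-1) => Y'; ring.
- move=> N N0; have [s [N' [E npN']]] := factor_out ip N0.
  exists (m * s)%N, (w ^+ s)%:P, N'%:P; rewrite !coefC /=; split=> //.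
    by elim: s {E} => [|s IH]; rewrite ?irreducible_ndvd1 // exprS irreducible_dvdM // negb_or npw.
  rewrite !xyevalE exprM ym E -rmorphXn -!rmorphM.
  by congr (xpoly F _); rewrite Ef exprMn; ring.
Qed.

Lemma map_curve_poly (K : fieldType) (rho : {rmorphism {poly k} -> K}) :
  map_poly rho (curve_poly f m) = 'X^m - (rho f)%:P.
Proof. by rewrite rmorphB /= map_polyXn map_polyC. Qed.

(** Modulo p write X^m - f = h1 h2.  By separability h2 is off the prime, and it
    carries the multiples of h1 to multiples of X^m - f, that is to multiples
    of p in k[x, y]. *)
Lemma unramified_local_prime (K : fieldType) (rho : {rmorphism {poly k} -> K}) p h1 :
  irreducible_poly p ->
  (forall c, exists g : {poly k}, rho g = c) -> (forall g : {poly k}, rho g = 0 <-> p %| g) ->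
  irreducible_poly h1 -> separable_poly ('X^m - (rho f)%:P) ->
  h1 %| 'X^m - (rho f)%:P ->
  local_prime y (fun g => h1 %| map_poly rho g) p%:P.
Proof.
move=> ip rsurj rker ih sepc /dvdpP[h2 Ec].
have p0 := irredp_neq0 ip.
have rp : rho p = 0 by apply/rker.
have nh2 : ~~ (h1 %| h2).
  apply/negP => hh; have := separable_coprime sepc (_ : h2 * h1 %| _).
  rewrite -Ec => /(_ (dvdpp _)) /coprimepP /(_ h1 hh (dvdpp _)).
  by rewrite -size_poly_eq1 => /eqP sh; case: ih; rewrite sh.
split.
- by rewrite rmorph1 irreducible_ndvd1.
- by move=> g h; rewrite rmorphM irreducible_dvdM.
- by move=> g h; rewrite rmorphD; apply: dvdp_add.
- by move=> g /kerF[q ->]; rewrite rmorphM /= map_curve_poly Ec !dvdp_mull.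
- by rewrite /= map_polyC /= rp dvdp0.
- by rewrite xyevalC xpoly_eq0.
- move=> g /dvdpP[g' Eg].
  have [H2 EH2] := map_poly_surj rsurj h2; have [G' EG'] := map_poly_surj rsurj g'.
  have Z : map_poly rho (H2 * g - G' * curve_poly f m) = 0.
    by rewrite rmorphB !rmorphM /= map_curve_poly EH2 EG' Eg Ec; ring.
  have [|v Ev] := @polyC_dvd_coef _ p (H2 * g - G' * curve_poly f m) p0.
    by move=> i; apply/rker; rewrite -coef_map Z coef0.
  exists H2, v; rewrite EH2; split=> //.
  rewrite -Ev /curve_poly !xyevalE ym subrr.
  by rewrite mulr0 subr0.
- move=> N N0; have [s [N' [E npN']]] := factor_out ip N0.
  exists s, 1, N'%:P; rewrite rmorph1 irreducible_ndvd1 //; split=> //.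
    rewrite /= map_polyC /=; apply/negP => /dvdp_leq.
    rewrite polyC_eq0; have rN : rho N' != 0 by apply/eqP => /rker; apply/negP.
    by move=> /(_ rN); rewrite size_polyC rN leqNgt; case: ih => ->.
  by rewrite mul1r E -rmorphXn -rmorphM.
Qed.

Lemma in_ring_x_of_ideal P p : p != 0 -> in_ideal P (xpoly F p) -> in_ring P x.
Proof.
move=> p0; apply: contraLR; rewrite /in_ring negb_or -ltNge => /andP[_ Px].
rewrite /in_ideal xpoly_eq0 (negPf p0) /= pval_xpoly_inf // -leNgt.
by rewrite mulr_le0_ge0 // ltW.
Qed.

Lemma in_ring_y P : in_ring P x -> in_ring P y.
Proof.
move=> Rx; have := in_ring_xpoly f Rx; rewrite -ym /in_ring expf_eq0 (negPf y0) andbF /=.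
by rewrite pvalX ?y0 // pmulrn_lge0.
Qed.

(** If p divides f, the least i with b_i prime to p is the order of b at the
    place above p, and i < m while p has order m.  Otherwise b is nonzero modulo
    p and of degree less than m, so it is missed by an irreducible factor of
    X^m - f modulo p, and b is a unit at the corresponding place. *)
Lemma place_above_pole p (b : S) : separable_poly f -> (m%:R : k) != 0 ->
  irreducible_poly p -> (size b <= m)%N -> (exists i, ~~ (p %| b`_i)) ->
  exists P, [/\ in_ideal P (xpoly F p), Phi b != 0 & P (Phi b) < P (xpoly F p)].
Proof.
move=> sepf mk ip bm bi; have p0 := irredp_neq0 ip.
have xp0 : xpoly F p != 0 by rewrite xpoly_eq0.
have [/dvdpP[w]|npf] := boolP (p %| f).
  rewrite mulrC => Ef.
  have npw : ~~ (p %| w).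
    apply/negP => pw; have := separable_coprime sepf (_ : p * w %| _).
    rewrite -Ef => /(_ (dvdpp _)) /coprimepP /(_ p (dvdpp _) pw).
    by rewrite -size_poly_eq1 => /eqP sh; case: ip; rewrite sh.
  have LP := ramified_local_prime ip Ef npw.
  have [P [unitP Py]] := local_place fracF LP; rewrite xyevalX in Py.
  have Pw : P (xpoly F w) = 0.
    by rewrite -(xyevalC y) unitP //= coefC.
  have Pp : P (xpoly F p) = m%:Z.
    have w0 : xpoly F w != 0 by rewrite xpoly_eq0; apply: contraNneq npw => ->; rewrite dvdp0.
    have := pvalX P m y0; rewrite ym Ef rmorphM pvalM // Pw Py addr0 => ->.
    by rewrite natz.
  have idp : in_ideal P (xpoly F p) by rewrite /in_ideal Pp ltz_nat m_gt0 orbT.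
  have Rx := in_ring_x_of_ideal p0 idp; have Ry := in_ring_y Rx.
  exists P; rewrite idp Pp.
  have [i nbi imin] := ex_minnP bi.
  have im : (i < m)%N.
    rewrite ltnNge; apply: contra nbi => mi.
    by rewrite nth_default ?dvdp0 // (leq_trans bm).
  have [v Ev] : exists v, take_poly i b = p%:P * v.
    apply: polyC_dvd_coef => // j; rewrite coef_take_poly; case: ltnP => ji; last exact: dvdp0.
    by apply: contraTT ji => /imin; rewrite -leqNgt.
  have nd : ~~ (p %| (drop_poly i b)`_0) by rewrite coef_drop_poly add0n.
  have Pd := unitP _ nd; have d0 := lp_neq0 LP nd.
  have [||A B] := @pvalD_lt _ _ _ P (Phi (drop_poly i b * 'X^i)) (Phi (take_poly i b)).
  - by rewrite !xyevalE mulf_neq0 ?expf_neq0 ?y0.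
  - rewrite Ev !xyevalE.
    have [->|v0] := eqVneq (Phi v) 0; [by left; rewrite mulr0 | right].
    rewrite (pvalM P d0) ?expf_neq0 ?y0 // Pd add0r pvalX ?y0 // Py pvalM // Pp natz.
    have := in_ring_xyeval v Rx Ry; rewrite /in_ring (negPf v0) /= => Pv.
    by apply: lt_le_trans (_ : m%:Z <= _); rewrite ?ltz_nat // lerDl.
  move: A B; rewrite -xyevalD addrC poly_take_drop => A ->; split=> //.
  by rewrite !xyevalE (pvalM P d0) ?expf_neq0 ?y0 // Pd add0r pvalX ?y0 // Py natz ltz_nat.
have [K [rho [rsurj rker]]] := residue_field ip.
have rf : rho f != 0 by apply/eqP => /rker; apply/negP.
have mK : (m%:R : K) != 0.
  have := fmorph_eq0 (rho \o @polyC k)%FUN (m%:R : k).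
  by rewrite (negPf mk) /= => /negbT; rewrite polyC_natr rmorph_nat.
have sepc := separable_Xn_sub m_gt0 mK rf.
have rb : map_poly rho b != 0.
  case: bi => i nbi; apply/eqP => /(congr1 (fun q : {poly K} => q`_i)).
  by rewrite coef_map coef0 => /rker; apply/negP.
have [|h1 [ih hc hb]] := separable_factor_ndvd sepc rb.
  by rewrite size_XnsubC // ltnS (leq_trans (size_poly _ _)).
have LP := unramified_local_prime ip rsurj rker ih sepc hc.
have [P [unitP Pt]] := local_place fracF LP; rewrite xyevalC in Pt.
exists P; rewrite /in_ideal Pt ltr01 orbT (lp_neq0 LP hb); split=> //.
by rewrite (unitP _ hb).
Qed.

End CurvePlaces.

(** * Rational points and completely split fibres *)

Section Points.
Variables (k : fieldType) (F : fieldExtType {fraction {poly k}}) (y : F).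
Variables (f : {poly k}) (m : nat).
Hypotheses (m_gt0 : (0 < m)%N) (f0 : f != 0) (ym : y ^+ m = xpoly F f).
Hypotheses (sepf : separable_poly f) (mk : (m%:R : k) != 0).
Hypothesis kerF : forall g, xyeval y g = 0 -> exists q, g = q * curve_poly f m.
Hypothesis fracF : forall z : F, exists (g : {poly {poly k}}) (N : {poly k}),
  N != 0 /\ z * xpoly F N = xyeval y g.

Local Notation S := {poly {poly k}}.
Local Notation x := (xpoly F 'X).
Local Notation Phi := (xyeval y).
Implicit Types (P : place (const_ext F)) (g : S).

Definition centered P (c b : k) : Prop := has_value P x c /\ has_value P y b.

Lemma XsubC_ideal P c : in_ideal P (xpoly F ('X - c%:P)) = in_ideal P (x - const_ext F c).
Proof. by rewrite rmorphB. Qed.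

Lemma in_ring_of_value P z c : has_value P z c -> in_ring P z.
Proof.
move=> H; rewrite -[z](subrK (const_ext F c)); apply: pgeD.
  exact: in_ideal_ring.
exact: in_ring_const.
Qed.

Lemma has_value_xpoly P c (p : {poly k}) : has_value P x c ->
  has_value P (xpoly F p) p.[c].
Proof.
move=> Hx; have Rx := in_ring_of_value Hx.
have /factor_theorem[q Eq] : root (p - p.[c]%:P) c by rewrite /root !hornerE subrr.
rewrite /has_value -xpolyC -rmorphB Eq rmorphM; apply: in_idealMr.
  exact: in_ring_xpoly.
by rewrite XsubC_ideal.
Qed.

Lemma has_value_xyeval P c b g : centered P c b ->
  has_value P (Phi g) (g.[b%:P]).[c].
Proof.
move=> [Hx Hy]; have [Rx Ry] := (in_ring_of_value Hx, in_ring_of_value Hy).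
have /factor_theorem[q Eq] : root (g - (g.[b%:P])%:P) b%:P.
  by rewrite /root !hornerE subrr.
have E : Phi g = Phi q * (y - const_ext F b) + xpoly F (g.[b%:P]).
  by rewrite -[in LHS](subrK (g.[b%:P])%:P g) Eq !xyevalE.
rewrite /has_value E -addrA; apply: in_idealD; last exact: has_value_xpoly.
by apply: in_idealMr => //; apply: in_ring_xyeval.
Qed.

Lemma centered_curve P c b : centered P c b -> b ^+ m = f.[c].
Proof.
move=> H; have := has_value_xyeval (curve_poly f m) H.
rewrite /curve_poly !xyevalE ym subrr /has_value sub0r in_idealN in_ideal_const.
by rewrite !hornerE subr_eq0 => /eqP.
Qed.

Lemma centered_unit P c b g : centered P c b -> (g.[b%:P]).[c] != 0 -> P (Phi g) = 0.
Proof.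
move=> H g0; have Hg := has_value_xyeval g H.
have [] // := pval_congr _ _ Hg; first by rewrite fmorph_eq0.
by rewrite pval_const.
Qed.

Lemma separable_XsubC c w : f = ('X - c%:P) * w -> w.[c] != 0.
Proof.
move=> Ef; have := separable_coprime sepf (_ : ('X - c%:P) * w %| _).
rewrite -Ef => /(_ (dvdpp _)) /coprimepP /(_ ('X - c%:P) (dvdpp _)).
rewrite -size_poly_eq1 size_XsubC => H; apply/negP => w0.
by have := H _; rewrite -root_factor_theorem => /(_ w0).
Qed.

Lemma horner_eval_kernel (c : k) (g : {poly k}) :
  horner_eval c g = 0 <-> 'X - c%:P %| g.
Proof. by rewrite dvdp_XsubCl; split=> [/eqP|/rootP]. Qed.

Lemma horner_eval_surj (c u : k) : exists g : {poly k}, horner_eval c g = u.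
Proof. by exists u%:P; rewrite /horner_eval hornerC. Qed.

Lemma curve_point_separable c : f.[c] != 0 -> separable_poly ('X^m - (horner_eval c f)%:P).
Proof. exact: separable_Xn_sub. Qed.

(** Smoothness of the curve: y is a local parameter where f(c) = 0, and x - c is
    one elsewhere. *)
Lemma point_local_prime c b : b ^+ m = f.[c] ->
  exists t, local_prime y (fun g => (g.[b%:P]).[c] == 0) t.
Proof.
move=> Eb; have [fc|fc] := eqVneq f.[c] 0.
  have b0 : b = 0 by apply/eqP; move/eqP: Eb; rewrite fc expf_eq0 m_gt0.
  have /factor_theorem[w] : root f c by apply/rootP.
  rewrite mulrC => Ef; exists 'X.
  have -> : (fun g : S => (g.[b%:P]).[c] == 0) = (fun g => 'X - c%:P %| g`_0).
    by apply: funext => g; rewrite b0 polyC0 horner_coef0 dvdp_XsubCl.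
  apply: (ramified_local_prime m_gt0 f0 ym kerF (irredp_XsubC c) Ef).
  by rewrite dvdp_XsubCl; apply: separable_XsubC.
exists ('X - c%:P)%:P.
have -> : (fun g : S => (g.[b%:P]).[c] == 0) =
    (fun g => 'X - b%:P %| map_poly (horner_eval c) g).
  apply: funext => g; rewrite dvdp_XsubCl /root.
  by rewrite -[b in RHS](hornerC b c) -/(horner_eval c _) horner_map.
apply: (unramified_local_prime ym kerF (irredp_XsubC c) (horner_eval_surj c)
  (horner_eval_kernel c) (irredp_XsubC b) (curve_point_separable fc)).
by rewrite dvdp_XsubCl /root !hornerE Eb subrr.
Qed.

Lemma centered_unique P P' c b : centered P c b -> centered P' c b -> P = P'.
Proof.
move=> H H'; have [t LP] := point_local_prime (centered_curve H).
have Ht (R : place (const_ext F)) : centered R c b -> in_ideal R (Phi t).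
  move=> HR; have := has_value_xyeval t HR.
  by rewrite (eqP (lp_unif LP)) /has_value rmorph0 subr0.
by apply: (local_place_unique fracF LP); do ?[move=> g; apply: centered_unit | exact: Ht].
Qed.

End Points.

Section RationalPoints.
Variables (k : finFieldType) (F : fieldExtType {fraction {poly k}}) (y : F).
Variables (f : {poly k}) (m : nat).
Hypotheses (m_gt0 : (0 < m)%N) (f0 : f != 0) (ym : y ^+ m = xpoly F f).
Hypotheses (sepf : separable_poly f) (mk : (m%:R : k) != 0).
Hypothesis kerF : forall g, xyeval y g = 0 -> exists q, g = q * curve_poly f m.
Hypothesis fracF : forall z : F, exists (g : {poly {poly k}}) (N : {poly k}),
  N != 0 /\ z * xpoly F N = xyeval y g.

Local Notation S := {poly {poly k}}.
Local Notation x := (xpoly F 'X).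
Local Notation Phi := (xyeval y).
Implicit Types (P : place (const_ext F)) (g : S).

Lemma centered_rational P c b : centered y P c b -> rational P.
Proof.
move=> H; have [t LP] := point_local_prime m_gt0 f0 ym sepf mk kerF (centered_curve ym H).
apply: rationalI => z Rz.
have unitP g : (g.[b%:P]).[c] != 0 -> P (Phi g) = 0 by apply: centered_unit.
have Pt : in_ideal P (Phi t).
  have := has_value_xyeval t H.
  by rewrite (eqP (lp_unif LP)) /has_value rmorph0 subr0.
have [g [h [Mh E]]] := local_ring fracF LP Rz unitP Pt.
pose u := (g.[b%:P]).[c]; pose v := (h.[b%:P]).[c].
exists (u / v); rewrite /has_value.
have h0 := lp_neq0 LP Mh.
have -> : z - const_ext F (u / v) = (Phi h)^-1 * Phi (g - (u / v)%:P%:P * h).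
  apply: (mulfI h0); rewrite mulVKf // xyevalB -E xyevalM xyevalC xpolyC; ring.
apply: in_idealMr; first by rewrite /in_ring pvalV unitP // oppr0 lexx orbT.
have := has_value_xyeval (g - (u / v)%:P%:P * h) H.
by rewrite !hornerE -/u -/v divfK // subrr /has_value rmorph0 subr0.
Qed.

Lemma rational_centered P : rational P -> in_ring P x -> exists c b, centered y P c b.
Proof.
move=> rP Rx; have [c Hc] := rational_value rP Rx.
have [b Hb] := rational_value rP (in_ring_y m_gt0 f0 ym Rx).
by exists c, b.
Qed.

Lemma centered_ramified P c : has_value P x c -> root f c -> centered y P c 0.
Proof.
move=> Hx /rootP fc; split=> //; have := has_value_xpoly f Hx.
by rewrite fc /has_value rmorph0 !subr0 -ym; apply: in_idealX.
Qed.

(** The polynomials in y that vanish at P form a prime ideal containing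
    X^m - f(c), hence one irreducible factor h of it; by Bezout the expressions
    not divisible by h above x = c are units at P. *)
Lemma unramified_factor P c : has_value P x c -> f.[c] != 0 ->
  exists h : {poly k}, [/\ irreducible_poly h, h %| 'X^m - f.[c]%:P,
   in_ideal P (Phi (map_poly polyC h)) &
   local_prime y (fun g => h %| map_poly (horner_eval c) g) ('X - c%:P)%:P /\
   (forall g, ~~ (h %| map_poly (horner_eval c) g) -> P (Phi g) = 0)].
Proof.
move=> Hx fc; have Rx := in_ring_of_value Hx; have Ry := in_ring_y m_gt0 f0 ym Rx.
pose I (h : {poly k}) := in_ideal P (Phi (map_poly polyC h)).
have IM h h' : I h -> I (h * h').
  rewrite /I rmorphM xyevalM => H; apply: in_idealMl => //; exact: in_ring_xyeval.
have ID h h' : I h -> I h' -> I (h + h').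
  by rewrite /I rmorphD xyevalD; apply: in_idealD.
have I1 : ~~ I 1 by rewrite /I rmorph1 rmorph1 in_ideal1.
have Icurve : I ('X^m - f.[c]%:P).
  have E : map_poly polyC ('X^m - f.[c]%:P) = 'X^m - f.[c]%:P%:P :> S.
    by rewrite rmorphB /= map_polyXn map_polyC.
  by rewrite /I E !xyevalE ym xpolyC; apply: has_value_xpoly.
have congrI g : in_ideal P (Phi g - Phi (map_poly polyC (map_poly (horner_eval c) g))).
  rewrite -xyevalB (xyeval_wide _ (leqnn _)); elim/big_ind: _ => //; first by rewrite /in_ideal eqxx.
    by move=> *; apply: in_idealD.
  move=> i _; apply: in_idealMl; last exact: in_ringX.
  rewrite coefB !coef_map /=; rewrite rmorphB; exact: has_value_xpoly.
have Iprime (g h : {poly k}) : I (g * h) -> I g || I h.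
  rewrite /I rmorphM xyevalM; apply: in_ideal_prime; exact: in_ring_xyeval.
have IC u : I u%:P -> u = 0.
  by rewrite /I map_polyC /= xyevalC xpolyC in_ideal_const => /eqP.
have [|h [ih hc hI]] := irreducible_factor_in Iprime IC _ Icurve.
  by rewrite monic_neq0 // monicXnsubC.
exists h; split=> //; split.
  exact: (unramified_local_prime ym kerF (irredp_XsubC c) (horner_eval_surj c)
    (horner_eval_kernel c) ih (curve_point_separable m_gt0 mk fc)).
move=> g; rewrite -irreducible_poly_coprime // => /Bezout_eq1_coprimepP[[u v] /= E].
apply: pval_unit; first exact: in_ring_xyeval.
apply: contra I1 => Ig; rewrite -E mulrC; apply: ID; first exact: IM.
rewrite mulrC; apply: IM; rewrite /I.
have := congrI g; rewrite -in_idealN opprB => H.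
by rewrite -[Phi (map_poly polyC _)](subrK (Phi g)); apply: in_idealD.
Qed.

(** Distinct places give coprime irreducible factors of X^m - f(c); as there are
    m of them, all are linear. *)
Lemma full_fibre_rational c (s : seq (place (const_ext F))) : f.[c] != 0 ->
  uniq s -> size s = m -> {in s, forall P, has_value P x c} ->
  {in s, forall P, rational P}.
Proof.
(* a is the size of one factor, b bounds the sum of the sizes of the others. *)
have arith (a b : nat) : ((a + b).+1 - m <= m.+1)%N -> (1 < a)%N -> (2 * m.-1 <= b)%N ->
    a = 2%N by clear -m_gt0; lia.
move=> fc us sm Hs.
have /choice[h Hh] P : exists h : {poly k}, P \in s ->
    [/\ irreducible_poly h, h %| 'X^m - f.[c]%:P, in_ideal P (Phi (map_poly polyC h)) &
   local_prime y (fun g => h %| map_poly (horner_eval c) g) ('X - c%:P)%:P /\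
   (forall g, ~~ (h %| map_poly (horner_eval c) g) -> P (Phi g) = 0)].
  have [Ps|] := boolP (P \in s); last by exists 0.
  by have [h H] := unramified_factor (Hs P Ps) fc; exists h.
have h0 P : P \in s -> h P != 0 by move=> /Hh[/irredp_neq0].
have cop : {in s &, forall P P', P != P' -> coprimep (h P) (h P')}.
  move=> P P' Ps Ps'; have [iP _ _ [LP UP]] := Hh P Ps; have [iP' _ _ [LP' UP']] := Hh P' Ps'.
  rewrite irreducible_poly_coprime //; apply: contraNN => hh.
  have E : h P %= h P'.
    by apply: iP'.2 => //; case: iP => + _; rewrite neq_ltn orbC => ->.
  apply/eqP; apply: (local_place_unique fracF LP) => //.
  - by rewrite xyevalC XsubC_ideal; apply: Hs.
  - by move=> g; rewrite (eqp_dvdl _ E); apply: UP'.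
  - by rewrite xyevalC XsubC_ideal; apply: Hs.
have dvd : \prod_(P <- s) h P %| 'X^m - f.[c]%:P.
  by apply: coprime_prod_dvd => // P /Hh[].
have := dvdp_leq (monic_neq0 (monicXnsubC f.[c] m_gt0)) dvd.
rewrite size_XnsubC // size_prod_seq // sm => le_m.
move=> P Ps; have [iP hdiv hI _] := Hh P Ps.
have sz2 : size (h P) = 2%N.
  have s1 : (1 < size (h P))%N by case: iP.
  have : (2 * (size s).-1 <= \sum_(R <- rem P s) size (h R))%N.
    rewrite -(size_rem Ps) mulnC -sum1_size big_distrl /= big_seq [leqRHS]big_seq.
    by apply: leq_sum => R /mem_rem Rs; rewrite mul1n; have [[]] := Hh R Rs.
  move: le_m; rewrite (perm_big _ (perm_to_rem Ps)) big_cons sm /=.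
  by move: (\sum_(R <- rem P s) size (h R))%N => b le_m; apply: arith.
have [b /[dup] rb] := poly2_root sz2; rewrite -dvdp_XsubCl => bh.
have Eh : 'X - b%:P %= h P by apply: iP.2 => //; rewrite size_XsubC.
have Hx := Hs P Ps; have Rx := in_ring_of_value Hx.
apply: (@centered_rational P c b); split=> //.
have /dvdpP[q Eq] : h P %| 'X - b%:P by rewrite -(eqp_dvdl _ Eh).
have : in_ideal P (Phi (map_poly polyC ('X - b%:P))).
  rewrite Eq rmorphM xyevalM; apply: in_idealMr => //.
  by apply: in_ring_xyeval => //; apply: (in_ring_y m_gt0 f0 ym).
have -> : map_poly polyC ('X - b%:P) = 'X - b%:P%:P :> S.
  by rewrite rmorphB /= map_polyX map_polyC.
by rewrite !xyevalE xpolyC.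
Qed.

Lemma unramified_pval P c : has_value P x c -> f.[c] != 0 ->
  P (xpoly F ('X - c%:P)) = 1.
Proof.
move=> Hx fc; have [h [_ _ _ [LP UP]]] := unramified_factor Hx fc.
rewrite -(xyevalC y); apply: (pval_local_unif fracF LP UP).
by rewrite xyevalC XsubC_ideal.
Qed.

End RationalPoints.

(** * Counting the zeros of a function *)

(** In bases adapted to the matrix specialized at c, each row beyond its rank is
    divisible by X - c. *)
Lemma det_corank (k : fieldType) n (A : 'M[{poly k}]_n) c :
  ('X - c%:P) ^+ (n - \rank (map_mx (horner_eval c) A)) %| \det A.
Proof.
set A0 := map_mx _ A; set p := 'X - c%:P; set rk := \rank A0.
pose L := map_mx (@polyC k) (col_ebase A0); pose U := map_mx (@polyC k) (row_ebase A0).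
pose L' := map_mx (@polyC k) (invmx (col_ebase A0)).
pose U' := map_mx (@polyC k) (invmx (row_ebase A0)).
pose B := L' *m A *m U'.
have LL' : L *m L' = 1%:M by rewrite -map_mxM mulmxV ?col_ebase_unit // map_mx1.
have UU' : U' *m U = 1%:M by rewrite -map_mxM mulVmx ?row_ebase_unit // map_mx1.
have EA : A = L *m B *m U by rewrite /B !mulmxA LL' mul1mx -mulmxA UU' mulmx1.
have mapC (M : 'M[k]_n) : map_mx (horner_eval c) (map_mx (@polyC k) M) = M.
  by apply/matrixP => i j; rewrite !mxE /horner_eval hornerC.
have B0 : map_mx (horner_eval c) B = pid_mx rk.
  rewrite !map_mxM !mapC -/A0.
  (* A0 is col_ebase A0 times pid_mx rk times row_ebase A0. *)
  transitivity (invmx (col_ebase A0) *m (col_ebase A0 *m pid_mx rk *m row_ebase A0)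
    *m invmx (row_ebase A0)); first by rewrite mulmx_ebase.
  rewrite !mulmxA mulVmx ?col_ebase_unit // mul1mx -mulmxA mulmxV ?row_ebase_unit //.
  by rewrite mulmx1.
move: B EA B0 => B EA B0.
have pB (i j : 'I_n) : (rk <= i)%N -> p %| B i j.
  move=> ri; have := congr1 (fun M : 'M_n => M i j) B0; rewrite !mxE.
  by rewrite ltnNge ri andbF /= => H; rewrite dvdp_XsubCl; apply/rootP.
pose d : 'rV[{poly k}]_n := \row_i (if (i < rk)%N then 1 else p).
pose B' : 'M[{poly k}]_n := \matrix_(i, j) (if (i < rk)%N then B i j else B i j %/ p).
have EB : B = diag_mx d *m B'.
  apply/matrixP => i j; rewrite mul_diag_mx !mxE; case: ltnP => ri; first by rewrite mul1r.
  by rewrite mulrC divpK // pB.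
rewrite EA !det_mulmx EB det_mulmx det_diag.
apply: dvdp_mulr; apply: dvdp_mull; apply: dvdp_mulr.
under eq_bigr do rewrite mxE.
rewrite -(big_mkord xpredT (fun i => if (i < rk)%N then 1 else p)).
rewrite (big_cat_nat (leq0n _) (rank_leq_row A0)) /=.
apply: dvdp_mull; rewrite [X in _ %| X]big_nat_cond.
rewrite (eq_bigr (fun=> p)); last by move=> i /andP[/andP[ri _] _]; rewrite ltnNge ri.
by rewrite -big_nat_cond prodr_const_nat.
Qed.

Lemma rank_Vandermonde (k : fieldType) m (s : seq k) : uniq s -> (size s <= m)%N ->
  \rank (\matrix_(i < m, j < size s) s`_j ^+ i) = size s.
Proof.
move=> us sm; set W := \matrix_(_, _) _; apply/eqP; rewrite eqn_leq rank_leq_col /=.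
pose a : 'rV[k]_(size s) := \row_j s`_j.
have E : rowsub (widen_ord sm) W = Vandermonde (size s) a.
  by apply/matrixP => i j; rewrite !mxE.
rewrite -[leqLHS](@mxrank_unit _ _ (Vandermonde (size s) a)).
  by rewrite -E mxrankS // rowsub_sub.
rewrite unitmxE det_Vandermonde unitfE.
apply/prodf_neq0 => i _; apply/prodf_neq0 => j ij.
by rewrite !mxE subr_eq0 nth_uniq // eq_sym ltn_eqF.
Qed.

(** The matrix of multiplication by g on k[x][y]/(y^m - f), in the basis of powers of y. *)
Definition mul_matrix (k : fieldType) (f : {poly k}) m (g : {poly {poly k}}) :
  'M[{poly k}]_m :=
  \matrix_(i, j) (if (i <= j)%N then g`_(j - i) else f * g`_(m + j - i)).

Section ZeroCount.
Variables (k : finFieldType) (f : {poly k}) (m : nat) (g : {poly {poly k}}).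
Hypotheses (m_gt0 : (0 < m)%N) (gm : (size g <= m)%N).

Local Notation M := (mul_matrix f m g).

Lemma mul_matrix_row (R : comNzRingType) (phi : {rmorphism {poly k} -> R}) (v : R) (i : 'I_m) :
  v ^+ m = phi f ->
  \sum_j phi (M i j) * v ^+ j = v ^+ i * \sum_(l < m) phi g`_l * v ^+ l.
Proof.
move=> vm; under eq_bigr do rewrite mxE.
have im := ltnW (ltn_ord i).
rewrite -(big_mkord xpredT (fun j => phi (if (i <= j)%N then g`_(j - i)
  else f * g`_(m + j - i)) * v ^+ j)) -(big_mkord xpredT (fun l => phi g`_l * v ^+ l)).
rewrite (big_cat_nat (leq0n i) im) /=.
rewrite [X in _ = _ * X](big_cat_nat (leq0n (m - i)) (leq_subr i m)) /=.
rewrite addrC mulrDr; congr (_ + _).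
  rewrite -{1}[val i]add0n big_addn mulr_sumr; apply: eq_bigr => l _.
  by rewrite leq_addl addnK exprD; ring.
(* The powers y^(i + l) with i + l >= m wrap around to f y^(i + l - m). *)
rewrite -{1}[(m - i)%N]add0n big_addn subKn // mulr_sumr big_nat [RHS]big_nat.
apply: eq_bigr => l /andP[_ li].
have -> : (l + (m - i) = m + l - i)%N by move: im; clear; lia.
rewrite leqNgt li rmorphM -vm /=.
rewrite mulrCA -exprD; have -> : (i + (m + l - i) = m + l)%N by move: im; clear; lia.
by rewrite exprD; ring.
Qed.

(** A kernel vector would be a nonzero element of F annihilated by g. *)
Lemma det_mul_matrix_neq0 (F : fieldExtType {fraction {poly k}}) (y : F) :
  y ^+ m = xpoly F f ->
  (forall h : {poly {poly k}}, (size h <= m)%N -> xyeval y h = 0 -> h = 0) ->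
  g != 0 -> \det M != 0.
Proof.
move=> ym inj g0; apply/negP => /det0P[v v0 vM].
have Pg0 : xyeval y g != 0 by apply: contra_neq g0 => /inj->.
pose h := \poly_(i < m) (if insub i is Some j then v 0 j else 0).
have hE (i : 'I_m) : h`_i = v 0 i by rewrite coef_poly ltn_ord valK.
have hm : (size h <= m)%N by apply: size_poly.
suff E : xyeval y h * xyeval y g = 0.
  move/eqP: E; rewrite mulf_eq0 (negPf Pg0) orbF => /eqP /(inj _ hm) h0.
  by case/eqP: v0; apply/rowP => i; rewrite -hE h0 coef0 mxE.
rewrite (xyeval_wide y hm) (xyeval_wide y gm) mulr_suml.
transitivity (\sum_(i < m) \sum_(j < m) xpoly F (v 0 i * M i j) * y ^+ j).
  apply: eq_bigr => i _; rewrite -mulrA -(mul_matrix_row _ ym) mulr_sumr.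
  by apply: eq_bigr => j _; rewrite hE rmorphM mulrA.
rewrite exchange_big big1 // => j _; rewrite -mulr_suml -rmorph_sum.
have := congr1 (fun u : 'rV_m => u 0 j) vM; rewrite !mxE => ->.
by rewrite rmorph0 mul0r.
Qed.

(** Points of the curve over x = c on which g vanishes give kernel vectors of the
    specialized matrix, independent by Vandermonde. *)
Lemma det_fibre_dvd c (s : seq k) : uniq s ->
  {in s, forall b, b ^+ m = f.[c] /\ (g.[b%:P]).[c] = 0} ->
  ('X - c%:P) ^+ size s %| \det M.
Proof.
move=> us Hs; have sm : (size s <= m)%N.
  have p0 : 'X^m - f.[c]%:P != 0 by rewrite monic_neq0 // monicXnsubC.
  rewrite -ltnS -(size_XnsubC f.[c] m_gt0); apply: max_poly_roots => //.
  by apply/allP => b /Hs[bm _]; rewrite /root !hornerE bm subrr.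
apply: dvdp_trans (det_corank M c); apply: dvdp_exp2l.
pose W := \matrix_(i < m, j < size s) s`_j ^+ i.
suff AW : map_mx (horner_eval c) M *m W = 0.
  by have := mulmx0_rank_max AW; rewrite (rank_Vandermonde us sm) -leq_subRL ?rank_leq_row.
apply/matrixP => i j; rewrite !mxE.
have [bm gb] := Hs s`_j (mem_nth 0 (ltn_ord j)).
transitivity (\sum_l horner_eval c (M i l) * s`_j ^+ l).
  by apply: eq_bigr => l _; rewrite !mxE.
rewrite (@mul_matrix_row k (horner_eval c) s`_j i bm).
suff -> : \sum_(l < m) horner_eval c g`_l * s`_j ^+ l = 0 by rewrite mulr0.
rewrite -[RHS]gb (horner_coef_wide _ gm) horner_sum; apply: eq_bigr => l _.
by rewrite /horner_eval !hornerE.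
Qed.

Section Degree.
Variables (r B e : nat).
Hypothesis size_f : size f = r.+1.
Hypothesis deg_g : forall i : nat, g`_i != 0 ->
  (m * (size (g`_i)%R).-1 + r * i + e <= m * B)%N.

(** With weight m for x and weight r for y, multiplication by g raises the weight
    of a power of y by at most m B - e. *)
Lemma size_mul_matrix (i j : 'I_m) : M i j != 0 ->
  (m * (size (M i j)).-1 + r * j + e <= m * B + r * i)%N.
Proof.
rewrite mxE; have [im jm] := (ltn_ord i, ltn_ord j); case: leqP => ij.
  have -> : (r * j = r * i + r * (j - i))%N by rewrite -mulnDr subnKC.
  by move/deg_g; move: (m * (size _).-1)%N (r * (j - i))%N (r * i)%N (m * B)%N; clear; lia.
rewrite mulf_eq0 negb_or => /andP[f0 gl]; have := deg_g gl.
rewrite size_mul // size_f addSn /=.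
have := size_poly_gt0 (g`_(m + j - i)); rewrite gl.
case: (size _) => // d _ /=.
have -> : (r * (m + j - i) = r * m + r * j - r * i)%N by rewrite mulnBr mulnDr.
have : (r * i <= r * m)%N by rewrite leq_mul2l (ltnW im) orbT.
rewrite addnS /= mulnDr; move: (r * i)%N (m * d)%N (m * B)%N (r * j)%N; rewrite (mulnC r m).
by move: (m * r)%N => *; lia.
Qed.

(** In the Leibniz formula the weights r i and r s(i) cancel over each
    permutation s. *)
Lemma size_det_mul_matrix : (e <= m * B)%N -> (size (\det M) + e <= (m * B).+1)%N.
Proof.
move=> emB; suff : (size (\det M) <= (m * B - e).+1)%N by lia.
apply: leq_trans (size_sum _ _ _) _; apply/bigmax_leqP => s _.
have -> : size ((-1) ^+ s * \prod_i M i (s i)) = size (\prod_i M i (s i)).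
  by case: (s : bool); rewrite ?expr0 ?expr1 ?mul1r // mulN1r size_polyN.
have [/existsP[i /eqP Mi]|] := boolP [exists i, M i (s i) == 0].
  by rewrite (bigD1 i) //= Mi mul0r size_poly0.
rewrite negb_exists => /forallP M0.
rewrite size_prod; last by move=> i _; apply: M0.
have -> : (\sum_i size (M i (s i)) = \sum_i (size (M i (s i))).-1 + m)%N.
  rewrite -[X in (_ + X)%N]card_ord -sum1_card -big_split /=; apply: eq_bigr => i _.
  by rewrite addn1 prednK // size_poly_gt0 M0.
rewrite (eq_card (B := 'I_m)) // card_ord -addSn addnK ltnS.
have : (\sum_(i < m) (m * (size (M i (s i))).-1 + r * s i + e) <=
    \sum_(i < m) (m * B + r * i))%N.
  by apply: leq_sum => i _; apply: size_mul_matrix; apply: M0.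
rewrite !big_split /= -!big_distrr /= !sum_nat_const card_ord.
have -> : (\sum_(i < m) s i = \sum_(i < m) i)%N.
  by rewrite [RHS](reindex_inj (@perm_inj _ s)).
rewrite -addnA [X in (_ + X <= _)%N]addnC addnA leq_add2r -mulnDr leq_pmul2l //.
by lia.
Qed.

(** The slack e accounts for the point at infinity, where a zero of g lowers the
    degrees by one. *)
Lemma zero_count (Z : {set k * k}) : \det M != 0 -> (e <= m * B)%N ->
  (forall c b, (c, b) \in Z -> b ^+ m = f.[c] /\ (g.[b%:P]).[c] = 0) ->
  (#|Z| + e <= m * B)%N.
Proof.
move=> det0 emB HZ; have := size_det_mul_matrix emB.
pose fib c := enum [set b | (c, b) \in Z].
pose q := \prod_(c <- enum k) ('X - c%:P) ^+ size (fib c).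
have qd : q %| \det M.
  apply: coprime_prod_dvd (enum_uniq _) _ _ => [c c' _ _ cc'|c _].
    by apply/coprimep_expl/coprimep_expr; rewrite coprimep_XsubC root_XsubC eq_sym.
  by apply: det_fibre_dvd (enum_uniq _) _ => b; rewrite mem_enum inE => /HZ.
suff -> : #|Z| = (size q).-1.
  have q0 : q != 0 by apply: contraNneq det0 => q0; rewrite -dvd0p -q0.
  have := dvdp_leq det0 qd; rewrite -size_poly_gt0 in q0; move: q0.
  by move: (size q) (size (\det M)) (m * B)%N; lia.
rewrite size_prod_seq; last by move=> c _; rewrite expf_neq0 // polyXsubC_eq0.
under eq_bigr do rewrite size_exp_XsubC.
rewrite -sum1_card (eq_bigl (fun u => (u.1, u.2) \in Z)); last by case.
rewrite -(pair_big_dep xpredT (fun c b => (c, b) \in Z) (fun _ _ => 1%N)) /=.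
rewrite -big_enum; under [in RHS]eq_bigr do rewrite -addn1.
rewrite big_split /= sum1_size -addSn addnK /=; apply: eq_bigr => c _.
by rewrite sum1dep_card /fib -cardE.
Qed.

End Degree.

End ZeroCount.

(** * The functions with poles at Q only *)

Section RiemannRochSpaces.
Variables (k : finFieldType) (F : fieldExtType {fraction {poly k}}) (y : F).
Variables (f : {poly k}) (m r : nat).
Hypotheses (m_gt1 : (1 < m)%N) (size_f : size f = r.+1) (coprime_mr : coprime m r).
Hypotheses (sepf : separable_poly f) (mk : (m%:R : k) != 0).
Hypotheses (ym : y ^+ m = xpoly F f) (genF : <<1; y>>%VS = fullv).
Variable Qoo : place (const_ext F).
Hypothesis Qoo_x : Qoo (xpoly F 'X) < 0.

Local Notation S := {poly {poly k}}.
Local Notation x := (xpoly F 'X).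
Local Notation Phi := (xyeval y).
Implicit Types (P : place (const_ext F)) (g : S) (c : k).

Let m_gt0 : (0 < m)%N := ltnW m_gt1.
Let f0 : f != 0 := f_neq0 size_f.
Let y0 : y != 0 := y_neq0 m_gt0 size_f ym.

Let kerF g : Phi g = 0 -> exists q, g = q * curve_poly f m :=
  @xyeval_kernel _ _ _ _ _ _ m_gt0 size_f coprime_mr ym Qoo Qoo_x g.

Let fracF (z : F) : exists g (N : {poly k}), N != 0 /\ z * xpoly F N = Phi g.
Proof. by have [g [N [_ N0 E]]] := xyeval_frac m_gt0 ym genF z; exists g, N. Qed.

Lemma affine_or_inf P : in_ring P x \/ P = Qoo.
Proof.
have [Px|Px] := leP 0 (P x); first by left; rewrite /in_ring Px orbT.
by right; apply: (inf_unique m_gt0 size_f coprime_mr ym genF).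
Qed.

(** The place is that of the local prime with parameter y, and f/(x - c) is a
    unit there, so x - c has the order m of y^m. *)
Lemma ramified_pval P c : has_value P x c -> root f c ->
  P y = 1 /\ P (xpoly F ('X - c%:P)) = m%:Z.
Proof.
move=> Hx fc; have cP := centered_ramified ym Hx fc.
have /factor_theorem[w] := fc; rewrite mulrC => Ef.
have wc := separable_XsubC sepf Ef.
have npw : ~~ ('X - c%:P %| w) by rewrite dvdp_XsubCl.
have LP := ramified_local_prime m_gt0 f0 ym kerF (irredp_XsubC c) Ef npw.
have unitP g : ~~ ('X - c%:P %| g`_0) -> P (Phi g) = 0.
  rewrite dvdp_XsubCl => gc; apply: (centered_unit cP).
  by rewrite polyC0 horner_coef0.
have Py : P y = 1.
  rewrite -(xyevalX y); apply: (pval_local_unif fracF LP unitP).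
  by rewrite xyevalX; case: cP => _; rewrite /has_value rmorph0 subr0.
split=> //; have w0 : xpoly F w != 0.
  by rewrite xpoly_eq0; apply: contraNneq npw => ->; rewrite dvdp0.
have Pw : P (xpoly F w) = 0 by rewrite -(xyevalC y) unitP // coefC.
have := pvalX P m y0; rewrite ym Ef rmorphM pvalM ?w0 ?xpoly_eq0 ?polyXsubC_eq0 //.
by rewrite Pw Py addr0 => ->; rewrite natz.
Qed.

(** If f did not vanish at the value c of x, then x - c would have order 1 at Q
    (unramified_pval), while total ramification makes that order a multiple
    of m. *)
Lemma totally_ramified_root (Q : place (const_ext F)) : rational Q -> Q <> Qoo ->
  totally_ramified Q -> exists2 c, root f c & has_value Q x c.
Proof.
move=> rQ QQoo [p _ ram]; have [Rx|//] := affine_or_inf Q.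
have [c [b [Hx _]]] := rational_centered m_gt0 f0 ym rQ Rx.
exists c => //; apply/rootP/eqP; apply: contraT => fc.
have := unramified_pval m_gt0 f0 ym mk kerF fracF Hx fc.
rewrite ram (dim_curve m_gt0 size_f coprime_mr ym genF Qoo_x).
move=> /(congr1 absz); rewrite abszM => /eqP; rewrite muln_eq1 => /andP[/eqP m1 _].
by move: m_gt1; rewrite -[m]/(absz m) m1.
Qed.

Section TotallyRamifiedPlace.
Variables (Q : place (const_ext F)) (al : k).
Hypotheses (root_al : root f al) (Q_al : has_value Q x al).

Local Notation u := (xpoly F ('X - al%:P)).

Lemma Q_y : Q y = 1. Proof. by have [] := ramified_pval Q_al root_al. Qed.

Lemma Q_u : Q u = m%:Z. Proof. by have [] := ramified_pval Q_al root_al. Qed.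

Lemma u_neq0 : u != 0.
Proof. by rewrite xpoly_eq0 polyXsubC_eq0. Qed.

Lemma place_over_al P : has_value P x al -> P = Q.
Proof.
move=> Hx; exact: (centered_unique m_gt0 f0 ym sepf mk kerF fracF
  (centered_ramified ym Hx root_al) (centered_ramified ym Q_al root_al)).
Qed.

Lemma pval_u P : in_ring P x -> P <> Q -> P u = 0.
Proof.
move=> Rx PQ; apply: pval_unit; first exact: in_ring_xpoly.
by rewrite XsubC_ideal; apply/negP => /place_over_al.
Qed.

Lemma Qoo_neq_Q : Qoo <> Q.
Proof.
move=> E; have := in_ring_of_value Q_al; rewrite /in_ring xpoly_eq0 polyX_eq0 /=.
by rewrite -E leNgt Qoo_x.
Qed.

Lemma Qoo_u : Qoo u = - m%:Z.
Proof.
rewrite pval_xpoly_inf // ?polyXsubC_eq0 // size_XsubC mulr1.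
by have [] := pval_x_inf m_gt0 size_f coprime_mr ym genF Qoo_x.
Qed.

(** The order at Q of an expression in y is the least order of its terms,
    since these are pairwise incongruent mod m. *)
Lemma pval_Q_terms (n : int) g : (size g <= m)%N -> g != 0 -> n <= Q (Phi g) ->
  forall (i s : nat) (h : {poly k}), g`_i = ('X - al%:P) ^+ s * h -> h.[al] != 0 ->
  n <= (m * s + i)%N%:Z.
Proof.
move=> gm g0 nQ.
pose T (i : 'I_m) := xpoly F g`_i * y ^+ i.
have T0 (i : 'I_m) : (T i != 0) = (g`_i != 0).
  by rewrite mulf_eq0 expf_eq0 (negPf y0) andbF orbF xpoly_eq0.
have Qh (h : {poly k}) : h.[al] != 0 -> Q (xpoly F h) = 0.
  move=> ha; apply: pval_unit; first by apply/in_ring_xpoly/(in_ring_of_value Q_al).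
  apply: contra ha => Ih; have := has_value_xpoly h Q_al.
  rewrite /has_value -in_idealN opprB => H.
  by have := in_idealD H Ih; rewrite subrK in_ideal_const.
have Tv (i : 'I_m) s (h : {poly k}) : g`_i = ('X - al%:P) ^+ s * h -> h.[al] != 0 ->
    Q (T i) = (m * s + i)%N%:Z.
  move=> Eg ha; have h0 : h != 0 by apply: contraNneq ha => ->; rewrite horner0.
  rewrite /T Eg rmorphM rmorphXn /= pvalM ?mulf_neq0 ?expf_neq0 ?u_neq0 ?xpoly_eq0 //.
  rewrite pvalM ?expf_neq0 ?u_neq0 ?xpoly_eq0 // Qh // !pvalX ?u_neq0 //.
  by rewrite Q_u Q_y addr0 natz -mulr_natr natz PoszD PoszM.
have exT (i : 'I_m) : T i != 0 -> exists s (h : {poly k}),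
    g`_i = ('X - al%:P) ^+ s * h /\ h.[al] != 0.
  rewrite T0 => gi; have [s [h [E nd]]] := factor_out (irredp_XsubC al) gi.
  by exists s, h; split=> //; rewrite -rootE -dvdp_XsubCl.
have [||_ [i0 _ [_ Qi0 imin]]] := @pval_sum_distinct _ _ _ Q _ (index_enum 'I_m)
   T (index_enum_uniq _).
- move=> i j _ _ /exT[s [h [Ei hi]]] /exT[s' [h' [Ej hj]]].
  rewrite (Tv _ _ _ Ei hi) (Tv _ _ _ Ej hj) => -[E]; apply: val_inj => /=.
  have := congr1 (fun v => v %% m)%N E.
  by rewrite !(mulnC m) !modnMDl !modn_small.
- have dm : ((size g).-1 < m)%N.
    by apply: leq_trans gm; rewrite prednK // size_poly_gt0.
  apply/hasP; exists (Ordinal dm); first by rewrite mem_index_enum.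
  by rewrite T0 /= -lead_coefE lead_coef_eq0.
move=> i s h Eg ha.
have gi : g`_i != 0.
  rewrite Eg mulf_neq0 ?expf_neq0 ?polyXsubC_eq0 //.
  by apply: contraNneq ha => ->; rewrite horner0.
have im : (i < m)%N.
  by rewrite ltnNge; apply: contra gi => mi; rewrite nth_default // (leq_trans gm).
have := imin (Ordinal im) (mem_index_enum _); rewrite T0 => /(_ gi).
rewrite (Tv (Ordinal im) s h Eg ha); apply: le_trans; rewrite -Qi0.
by rewrite -(xyeval_wide y gm).
Qed.

(** The order of g at infinity is at least -mB. *)
Definition deg_bound (B : nat) g : Prop :=
  forall i : nat, g`_i != 0 -> (m * (size (g`_i)%R).-1 + r * i <= m * B)%N.

Lemma weight_bound B g : deg_bound B g -> (weight m r g <= m * B)%N.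
Proof. by move=> H; apply/bigmax_leqP => i gi; apply: H. Qed.

Lemma le_weight g (i : nat) : (size g <= m)%N -> g`_i != 0 ->
  (m * (size (g`_i)%R).-1 + r * i <= weight m r g)%N.
Proof.
move=> gm gi; have im : (i < m)%N.
  by rewrite ltnNge; apply: contra gi => mi; rewrite nth_default // (leq_trans gm).
exact: (@leq_bigmax_cond _ (fun i : 'I_m => g`_i != 0)
  (fun i : 'I_m => m * (size (g`_i)%R).-1 + r * i)%N (Ordinal im) gi).
Qed.

Lemma size_mul_polyC (p : {poly k}) g : p != 0 -> size (p%:P * g) = size g.
Proof.
move=> p0; have [->|g0] := eqVneq g 0; first by rewrite mulr0.
by rewrite size_mul ?polyC_eq0 // size_polyC p0.
Qed.

(** In a representation z = g/N with N of least degree, an irreducible factor of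
    N gives a pole of z by place_above_pole.  This pole can only be Q, so the
    factor is x - al. *)
Lemma denominator_at_Q (z : F) : (forall P, P <> Q -> P <> Qoo -> 0 <= P z) ->
  z != 0 -> exists s g, (size g <= m)%N /\ z * u ^+ s = Phi g.
Proof.
move=> Hz z0.
pose D n := `[< exists g (N : {poly k}), [/\ size N = n, (size g <= m)%N, N != 0 &
  z * xpoly F N = Phi g] >].
have exD : exists n, D n.
  have [g [N [gm N0 E]]] := xyeval_frac m_gt0 ym genF z.
  by exists (size N); apply/asboolP; exists g, N.
have [n /asboolP[g [N [sN gm N0 E]]] nmin] := ex_minnP exD.
have only p : irreducible_poly p -> p %| N -> p %= 'X - al%:P.
  move=> ip /dvdpP[N' EN]; have p0 := irredp_neq0 ip.
  have N'0 : N' != 0 by apply: contraNneq N0 => N'0; rewrite EN N'0 mul0r.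
  have [bi|nbi] := pselect (exists i, ~~ (p %| g`_i)); last first.
    have [|g' Eg] := @polyC_dvd_coef _ p g p0.
      by move=> i; apply: contra_notT nbi => nd; exists i.
    have : D (size N').
      apply/asboolP; exists g', N'; split=> //.
        by rewrite -(size_mul_polyC g' p0) -Eg.
      have up : xpoly F p != 0 by rewrite xpoly_eq0.
      apply: (mulIf up); rewrite -mulrA -rmorphM /= -EN E Eg xyevalM xyevalC.
      by rewrite mulrC.
    move/nmin; rewrite -sN EN size_mul //; have [sp _] := ip.
    have sN' : (0 < size N')%N by rewrite size_poly_gt0.
    by move: (size N') (size p) sp sN'; clear; lia.
  have [P [Ip b0 lt_b]] := place_above_pole m_gt0 f0 ym kerF fracF sepf mk ip gm bi.
  have Rx := in_ring_x_of_ideal p0 Ip.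
  have PQoo : P <> Qoo.
    by move=> EP; move: Rx; rewrite EP /in_ring xpoly_eq0 polyX_eq0 leNgt Qoo_x.
  have PQ : P = Q.
    apply: contrapT => PQ; have := Hz P PQ PQoo; apply/negP; rewrite -ltNge.
    have := pvalM P z0 (_ : xpoly F N != 0); rewrite xpoly_eq0 => /(_ N0).
    rewrite E EN rmorphM pvalM ?xpoly_eq0 // => EP.
    have := in_ring_xpoly N' Rx; rewrite /in_ring xpoly_eq0 (negPf N'0) /= => PN'.
    by move: EP lt_b PN'; move: (P (Phi g)) (P z) (P (xpoly F N')) (P (xpoly F p)); clear; lia.
  suff dp : p %| 'X - al%:P.
    have := (irredp_XsubC al).2 p _ dp; apply.
    by case: ip => + _; rewrite neq_ltn orbC => ->.
  apply: contraT; rewrite -irreducible_poly_coprime //.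
  move/Bezout_eq1_coprimepP => [[v w] /= Evw].
  have := in_ideal1 Q; rewrite -(rmorph1 (xpoly F)) -Evw rmorphD !rmorphM in_idealD //.
    by apply: in_idealMr; [apply/in_ring_xpoly/(in_ring_of_value Q_al) | rewrite -PQ].
  apply: in_idealMr; first by apply/in_ring_xpoly/(in_ring_of_value Q_al).
  by rewrite XsubC_ideal.
have [s [N' [EN nd]]] := factor_out (irredp_XsubC al) N0.
have N'0 : N' != 0 by apply: contraNneq N0 => N'0; rewrite EN N'0 mulr0.
have /size1_polyC EN' : (size N' <= 1)%N.
  rewrite leqNgt; apply/negP => /irreducible_factor[p ip pN'].
  have := only p ip; rewrite EN dvdp_mull // => /(_ isT) pe.
  by case/negP: nd; rewrite -(eqp_dvdl _ pe).
have c0 : N'`_0 != 0 by move: N'0; rewrite EN' polyC_eq0 coefC.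
move: (N'`_0) c0 EN' => c c0 EN'.
exists s, (c^-1%:P%:P * g); split.
  by rewrite size_mul_polyC // polyC_eq0 invr_eq0.
have K : xpoly F c^-1%:P * xpoly F N' = 1 by rewrite EN' -rmorphM -polyCM mulVf // rmorph1.
rewrite xyevalM -E EN xyevalC rmorphM rmorphXn /=.
transitivity (z * u ^+ s * (xpoly F c^-1%:P * xpoly F N')); first by rewrite K mulr1.
by move: (u ^+ s) (xpoly F c^-1%:P) (xpoly F N') => A B C; ring.
Qed.

Section Divisor.
Variable a : nat.
Hypotheses (a_gt0 : (0 < a)%N) (a_ltr : (a < r)%N).

Local Notation cQ := ((a * m)%:Z - ((a * m) %/ r)%:Z - 1).
Local Notation G := << cQ *g Q >>.

Lemma coeff_G P : coeff P G = cQ * (Q == P)%:R.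
Proof. by rewrite coeffU. Qed.

Lemma cQ_ge : (m * a.-1)%N%:Z <= cQ.
Proof.
have r0 : (0 < r)%N by apply: leq_trans a_ltr.
have : (a * m %/ r < m)%N by rewrite ltn_divLR // mulnC ltn_pmul2l.
move: (a * m %/ r)%N => fl; have -> : (a * m = m * a.-1 + m)%N.
  by rewrite mulnC -{1}(prednK a_gt0) mulnS addnC.
by move: (m * a.-1)%N m_gt1; clear; lia.
Qed.

(** A monomial y^i/(x - al)^j with r i <= m j that has pole order m j - i at most
    deg G at Q has j < a: for j >= a the bounds on i exclude each other.  This is
    why L(G) = L(m(a-1)Q).  Here j = n - s. *)
Lemma pole_order_gap (i s n : nat) : (m * s + r * i <= m * n)%N ->
  (n * m)%N%:Z - cQ <= (m * s + i)%N%:Z -> (n <= s + a.-1)%N.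
Proof.
move=> H1 H2; rewrite leqNgt; apply/negP => H3.
have r0 : (0 < r)%N by apply: leq_trans a_ltr.
have := ltn_ceil (a * m) r0; move: H2; move: (a * m %/ r)%N => fl H2 H4.
have [t Et] : exists t, n = (s + a + t)%N by exists (n - (s + a))%N; lia.
subst n; have H5 : (m * t + fl + 1 <= i)%N.
  have E1 : ((s + a + t) * m = m * s + a * m + m * t)%N by ring.
  by move: H2; rewrite E1; move: (m * s)%N (a * m)%N (m * t)%N; clear; lia.
have H6 : (r * i <= a * m + m * t)%N.
  have E1 : (m * (s + a + t) = m * s + (a * m + m * t))%N by ring.
  by move: H1; rewrite E1 leq_add2l.
have H7 : (r * (m * t + fl + 1) <= r * i)%N by rewrite leq_mul2l H5 orbT.
have H8 : (m * t <= r * (m * t))%N by rewrite leq_pmull.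
have E2 : (r * (m * t + fl + 1) = r * (m * t) + fl.+1 * r)%N by ring.
by move: H7; rewrite E2; move: (fl.+1 * r)%N (r * (m * t))%N (m * t)%N (a * m)%N (r * i)%N H4 H6 H8; clear; lia.
Qed.

Lemma RR_spaceI z g : (size g <= m)%N -> deg_bound a.-1 g ->
  z * u ^+ a.-1 = Phi g -> RR_space G z.
Proof.
move=> gm gB E; have [->|z0] := eqVneq z 0; [by left | right => P].
have u0 := u_neq0; have g0 : g != 0.
  apply: contraNneq z0 => g0; move: E; rewrite g0 rmorph0 => /eqP.
  by rewrite mulf_eq0 expf_eq0 (negPf u0) andbF orbF.
have Ev : P z + P u * a.-1%:Z = P (Phi g).
  by rewrite -E pvalM ?expf_neq0 // pvalX // -mulr_natr natz.
have ring_g : in_ring P x -> 0 <= P (Phi g).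
  move=> Rx; have := in_ring_xyeval g Rx (in_ring_y m_gt0 f0 ym Rx).
  by rewrite /in_ring; case/orP=> // /eqP->; rewrite pval0.
have [Rx|->{P Ev ring_g}] := affine_or_inf P; last first.
  rewrite coeff_G; case: eqP => [/esym/Qoo_neq_Q//|_]; rewrite mulr0 addr0.
  have := pval_inf m_gt0 size_f coprime_mr ym genF Qoo_x gm g0.
  rewrite -E pvalM ?expf_neq0 // pvalX // Qoo_u => Ew.
  have := weight_bound gB; move: Ew; rewrite -mulr_natr natz.
  by move: (weight m r g) (Qoo z); clear; lia.
rewrite coeff_G; case: eqP => [QP|QP]; last first.
  by rewrite mulr0 addr0; have := ring_g Rx; rewrite -Ev pval_u ?mul0r ?addr0 // => /esym.
rewrite mulr1 -QP in Ev ring_g Rx *; have := ring_g Rx; rewrite -Ev Q_u.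
by have := cQ_ge; rewrite PoszM; move: cQ (m%:Z * _) (Q z); clear; lia.
Qed.

(** Regularity off Q bounds denominators, the order at infinity bounds degrees,
    and the order at Q then forces the denominator down to (x - al)^(a-1). *)
Lemma RR_spaceE z : RR_space G z -> exists g,
  [/\ (size g <= m)%N, deg_bound a.-1 g & z * u ^+ a.-1 = Phi g].
Proof.
case=> [->|Gz].
  exists 0; split; rewrite ?size_poly0 ?mul0r ?rmorph0 //.
  by move=> i; rewrite coef0 eqxx.
have [->|z0] := eqVneq z 0.
  exists 0; split; rewrite ?size_poly0 ?mul0r ?rmorph0 //.
  by move=> i; rewrite coef0 eqxx.
have u0 := u_neq0.
have regz P : P <> Q -> 0 <= P z.
  by move=> PQ; have := Gz P; rewrite coeff_G; case: eqP => [/esym//|_]; rewrite mulr0 addr0.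
have [s [g0 [g0m E0]]] := denominator_at_Q (fun P PQ _ => regz P PQ) z0.
(* Enlarging the denominator keeps n - (a - 1) from being truncated. *)
pose p := 'X - al%:P; have p0 : p != 0 by rewrite polyXsubC_eq0.
pose n := (s + a.-1)%N; pose g := (p ^+ a.-1)%:P * g0.
have gm : (size g <= m)%N by rewrite size_mul_polyC // expf_neq0.
have E : z * u ^+ n = Phi g.
  by rewrite exprD mulrA E0 xyevalM xyevalC rmorphXn mulrC.
have gn0 : g != 0.
  apply: contraNneq z0 => gn0; move: E; rewrite gn0 rmorph0 => /eqP.
  by rewrite mulf_eq0 expf_eq0 (negPf u0) andbF orbF.
have degg (i : nat) : g`_i != 0 -> (m * (size (g`_i)%R).-1 + r * i <= m * n)%N.
  move=> gi; apply: leq_trans (le_weight gm gi) _.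
  have := pval_inf m_gt0 size_f coprime_mr ym genF Qoo_x gm gn0.
  rewrite -E pvalM ?expf_neq0 // pvalX // Qoo_u -mulr_natr natz.
  have := regz Qoo Qoo_neq_Q.
  by move: (weight m r g) (Qoo z); clear; lia.
have Qg : (n * m)%N%:Z - cQ <= Q (Phi g).
  rewrite -E pvalM ?expf_neq0 // pvalX // Q_u -mulr_natr natz.
  have := Gz Q; rewrite coeff_G eqxx mulr1 (PoszM n m) (mulrC n%:Z).
  by move: cQ (Q z) (m%:Z * n%:Z) => A B C; clear; lia.
have dvd_s i : p ^+ s %| g`_i.
  have [->|gi] := eqVneq g`_i 0; first exact: dvdp0.
  have [t [h [Eh nd]]] := factor_out (irredp_XsubC al) gi.
  have ha : h.[al] != 0 by rewrite -rootE -dvdp_XsubCl.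
  have h0 : h != 0 by apply: contraNneq ha => ->; rewrite horner0.
  have Qi := pval_Q_terms gm gn0 Qg Eh ha.
  have ti : (m * t + r * i <= m * n)%N.
    apply: leq_trans (degg i gi); rewrite leq_add2r leq_mul2l Eh.
    rewrite size_mul ?expf_neq0 // size_exp_XsubC addSn /=.
    have sh : (0 < size h)%N by rewrite size_poly_gt0.
    by case: (size h) sh => // d _; rewrite addnS leq_addr orbT.
  have := pole_order_gap ti Qi; rewrite /n leq_add2r => st.
  by rewrite Eh dvdp_mulr // dvdp_exp2l.
have [|g1 Eg1] := polyC_dvd_coef _ dvd_s; first by rewrite expf_neq0.
have g1m : (size g1 <= m)%N by rewrite -(size_mul_polyC g1 (expf_neq0 s p0)) -Eg1.
exists g1; split=> //.
  move=> i g1i; have gi : g`_i != 0 by rewrite Eg1 coefCM mulf_neq0 ?expf_neq0.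
  have := degg i gi; rewrite Eg1 coefCM size_mul ?expf_neq0 // size_exp_XsubC addSn /=.
  have := size_poly_gt0 g1`_i; rewrite g1i; case: (size _) => // d _.
  rewrite addnS /= /n !mulnDr -addnA leq_add2l //.
apply: (mulfI (expf_neq0 s u0)); rewrite mulrCA -exprD E Eg1 xyevalM xyevalC.
by rewrite rmorphXn.
Qed.

End Divisor.
End TotallyRamifiedPlace.
End RiemannRochSpaces.

(** * The code and its parameters *)

(** For l = a - 1 - j the exponent i runs from 0 to floor(jm/r), which is less than
    m because j < r. *)
Lemma card_monomials (m r a : nat) : (0 < m)%N -> (0 < a)%N -> (a < r)%N ->
  #|[set v : 'I_a * 'I_m | (m * v.1 + r * v.2 <= m * a.-1)%N]| =
  (a + \sum_(1 <= i < a) (i * m) %/ r)%N.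
Proof.
move=> m0 a0 ar; have r0 : (0 < r)%N by apply: leq_trans ar.
rewrite -sum1_card (eq_bigl (fun v : 'I_a * 'I_m => m * v.1 + r * v.2 <= m * a.-1)%N); last first.
  by move=> v; rewrite inE.
rewrite -(pair_big_dep xpredT (fun (l : 'I_a) (i : 'I_m) => m * l + r * i <= m * a.-1)%N
  (fun _ _ => 1%N)) /= (reindex_inj rev_ord_inj) /=.
transitivity (\sum_(j < a) ((j * m) %/ r + 1))%N.
  apply: eq_bigr => j _; have ja := ltn_ord j.
  have tm : ((j * m) %/ r < m)%N by rewrite ltn_divLR // mulnC ltn_pmul2l // (ltn_trans ja).
  rewrite (eq_bigl (fun i : 'I_m => (i < (j * m %/ r).+1)%N)).
    by rewrite -(@big_ord_widen _ _ _ _ m (fun=> 1%N) tm) sum1_card card_ord addn1.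
  move=> i; rewrite ltnS leq_divRL // [(i * r)%N]mulnC [(j * m)%N]mulnC.
  have -> : (a.-1 = a - j.+1 + j)%N by move: (nat_of_ord j) ja; clear; lia.
  by rewrite mulnDr leq_add2l.
rewrite big_split /= sum1_card card_ord addnC; congr (_ + _)%N.
by rewrite -(big_mkord xpredT (fun j => j * m %/ r)%N) big_ltn // mul0n div0n.
Qed.

Section Code.
Variables (k : finFieldType) (F : fieldExtType {fraction {poly k}}) (y : F).
Variables (f : {poly k}) (m r : nat).
Hypotheses (m_gt1 : (1 < m)%N) (size_f : size f = r.+1) (coprime_mr : coprime m r).
Hypotheses (sepf : separable_poly f) (mk : (m%:R : k) != 0).
Hypotheses (ym : y ^+ m = xpoly F f) (genF : <<1; y>>%VS = fullv).
Variable Qoo : place (const_ext F).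
Hypothesis Qoo_x : Qoo (xpoly F 'X) < 0.
Variables (Q : place (const_ext F)) (al : k).
Hypotheses (root_al : root f al) (Q_al : has_value Q (xpoly F 'X) al).
Variable a : nat.
Hypotheses (a_gt0 : (0 < a)%N) (a_ltr : (a < r)%N).

Local Notation S := {poly {poly k}}.
Local Notation x := (xpoly F 'X).
Local Notation Phi := (xyeval y).
Local Notation u := (xpoly F ('X - al%:P)).
Local Notation cQ := ((a * m)%:Z - ((a * m) %/ r)%:Z - 1).
Local Notation G := << cQ *g Q >>.
Implicit Types (P : place (const_ext F)) (g : S) (c : k).

Variables (n : nat) (ps : 'I_n -> place (const_ext F)).
Hypotheses (ps_inj : injective ps).
Hypothesis psE : forall P, (exists i, ps i = P) <-> rational P /\ P <> Q.
Hypothesis cQ_ltn : cQ < n%:Z.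

Let m_gt0 : (0 < m)%N := ltnW m_gt1.
Let f0 : f != 0 := f_neq0 size_f.
Let u0 : u != 0. Proof. by rewrite xpoly_eq0 polyXsubC_eq0. Qed.

Let kerF g : Phi g = 0 -> exists q, g = q * curve_poly f m :=
  @xyeval_kernel _ _ _ _ _ _ m_gt0 size_f coprime_mr ym Qoo Qoo_x g.

Let fracF (z : F) : exists g (N : {poly k}), N != 0 /\ z * xpoly F N = Phi g.
Proof. by have [g [N [_ N0 E]]] := xyeval_frac m_gt0 ym genF z; exists g, N. Qed.

Let RRE z : RR_space G z -> exists g,
  [/\ (size g <= m)%N, deg_bound m r a.-1 g & z * u ^+ a.-1 = Phi g].
Proof. exact: (RR_spaceE m_gt1 size_f coprime_mr sepf mk ym genF Qoo_x root_al Q_al a_gt0 a_ltr). Qed.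

Let RRI z g : (size g <= m)%N -> deg_bound m r a.-1 g ->
  z * u ^+ a.-1 = Phi g -> RR_space G z.
Proof. exact: (RR_spaceI m_gt1 size_f coprime_mr sepf mk ym genF Qoo_x root_al Q_al a_gt0 a_ltr). Qed.

Lemma pole_lt_length : (m * a.-1 < n)%N.
Proof.
have := cQ_ge m_gt1 a_gt0 a_ltr; move: cQ_ltn; move: cQ => C; clear; lia.
Qed.

Lemma rational_ps i : rational (ps i).
Proof. by have [] := (psE (ps i)).1 (ex_intro _ i erefl). Qed.

Lemma ps_neq_Q i : ps i <> Q.
Proof. by have [] := (psE (ps i)).1 (ex_intro _ i erefl). Qed.

(** The value of h at a place is unique but need not exist; the default 0 fills
    in. *)
Definition ev (h : F) : 'rV[k]_n := \row_i xget 0 (has_value (ps i) h).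

Lemma has_value_ev h i : RR_space G h -> has_value (ps i) h (ev h 0 i).
Proof.
move=> Gh; have Rh : in_ring (ps i) h.
  case: Gh => [->|/(_ (ps i))]; first by rewrite /in_ring eqxx.
  rewrite coeffU; case: eqP => [/esym/ps_neq_Q//|_].
  by rewrite mulr0 addr0 /in_ring => ->; rewrite orbT.
rewrite mxE; apply: xgetPex; exact: rational_value (rational_ps i) Rh.
Qed.

Lemma ev_unique h (v : 'rV_n) : RR_space G h ->
  (forall i, has_value (ps i) h (v 0 i)) -> v = ev h.
Proof.
move=> Gh Hv; apply/rowP => i; apply: has_value_unique (Hv i) _.
exact: has_value_ev.
Qed.

Lemma mem_code (v : 'rV_n) : v \in AG_code ps G <-> exists2 h, RR_space G h & v = ev h.
Proof.
split=> [/AG_codeP[h Gh Hv]|[h Gh ->]]; first by exists h; rewrite // (ev_unique Gh Hv).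
by apply/AG_codeP; exists h => // i; apply: has_value_ev.
Qed.

Lemma RR_spaceB h h' : RR_space G h -> RR_space G h' -> RR_space G (h - h').
Proof.
move=> Gh Gh'; have := RR_space_lin (-1) Gh' Gh.
by rewrite rmorphN1 mulN1r [- h' + h]addrC.
Qed.

Lemma evB h h' : RR_space G h -> RR_space G h' -> ev (h - h') = ev h - ev h'.
Proof.
move=> Gh Gh'; apply/esym/ev_unique; first exact: RR_spaceB.
move=> i; have -> : (ev h - ev h') 0 i = -1 * ev h' 0 i + ev h 0 i.
  by rewrite mxE [X in _ + X]mxE mulN1r addrC.
have -> : h - h' = const_ext F (-1) * h' + h by rewrite rmorphN1 mulN1r addrC.
by apply: has_value_lin; apply: has_value_ev.
Qed.

Definition zeros (h : F) : {set 'I_n} := [set i | ev h 0 i == 0].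

Lemma zerosE h i : RR_space G h -> (i \in zeros h) = in_ideal (ps i) h.
Proof.
move=> Gh; rewrite inE.
apply/idP/idP => [/eqP E|Ih]; first by move: (has_value_ev i Gh); rewrite E /has_value rmorph0 subr0.
apply/eqP; apply: has_value_unique (has_value_ev i Gh) _.
by rewrite /has_value rmorph0 subr0.
Qed.

Lemma code_dist h h' : RR_space G h -> RR_space G h' ->
  (hamming_dist (ev h) (ev h') + #|zeros (h - h')| = n)%N.
Proof.
move=> Gh Gh'; rewrite /hamming_dist -[RHS]card_ord addnC -(cardC (mem (zeros (h - h')))).
congr (_ + _)%N; apply: eq_card => i; rewrite !inE evB // !mxE.
by rewrite subr_eq0.
Qed.

(** Write h = g/(x - al)^(a-1).  The affine zeros of h are points of the curve at
    which g vanishes, and zero_count bounds their number.  At most one more zero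
    lies at infinity, and then the degree bound on g is strict. *)
Lemma zeros_le h : RR_space G h -> h != 0 -> (#|zeros h| <= m * a.-1)%N.
Proof.
move=> Gh h0; have [g [gm gB E]] := RRE Gh.
have g0 : g != 0.
  apply: contraNneq h0 => g0; move: E; rewrite g0 rmorph0 => /eqP.
  by rewrite mulf_eq0 expf_eq0 (negPf u0) andbF orbF.
have inj (g' : S) : (size g' <= m)%N -> Phi g' = 0 -> g' = 0.
  exact: (xyeval_inj m_gt0 size_f coprime_mr ym Qoo_x).
have det0 := det_mul_matrix_neq0 gm ym inj g0.
have /fin_all_exists[cen Hcen] i : exists cb : k * k,
    in_ring (ps i) x -> centered y (ps i) cb.1 cb.2.
  have [Rx|] := boolP (in_ring (ps i) x); last by exists (0, 0).
  have [c [b H]] := rational_centered m_gt0 f0 ym (rational_ps i) Rx.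
  by exists (c, b).
pose V0 := [set i in zeros h | in_ring (ps i) x].
pose Z := cen @: V0.
have cardZ : #|Z| = #|V0|.
  apply: card_in_imset => i j; rewrite !inE => /andP[_ Ri] /andP[_ Rj] Eij.
  apply: ps_inj; have Hj := Hcen j Rj; rewrite -Eij in Hj.
  exact: (centered_unique m_gt0 f0 ym sepf mk kerF fracF (Hcen i Ri) Hj).
have HZ c b : (c, b) \in Z -> b ^+ m = f.[c] /\ (g.[b%:P]).[c] = 0.
  case/imsetP => i; rewrite inE => /andP[Vi Ri] Ecb.
  have := Hcen i Ri; rewrite -Ecb /= => Hi; split; first exact: (centered_curve ym Hi).
  apply: has_value_unique (has_value_xyeval g Hi) _.
  rewrite /has_value rmorph0 subr0 -E mulrC; apply: in_idealMr.
    by apply/in_ringX/in_ring_xpoly.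
  by rewrite -zerosE.
have Vinf i : i \in zeros h -> i \notin V0 -> ps i = Qoo.
  rewrite [i \in V0]inE => -> /= Rx.
  by have [R|//] := affine_or_inf m_gt1 size_f coprime_mr ym genF Qoo_x (ps i); rewrite R in Rx.
have [sub|] := boolP (zeros h \subset V0).
  have := zero_count m_gt0 gm (r := r) (B := a.-1) (e := 0%N) size_f _ det0 (leq0n _) HZ.
  rewrite addn0 cardZ => H; apply: leq_trans (subset_leq_card sub) (H _).
  by move=> i gi; rewrite addn0; apply: gB.
case/subsetPn => i0 Vi0 NVi0; have Ei0 := Vinf i0 Vi0 NVi0.
have strict (i : nat) : g`_i != 0 -> (m * (size (g`_i)%R).-1 + r * i + 1 <= m * a.-1)%N.
  move=> gi; rewrite addn1; apply: leq_ltn_trans (le_weight r gm gi) _.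
  have := pval_inf m_gt0 size_f coprime_mr ym genF Qoo_x gm g0.
  rewrite -E pvalM ?expf_neq0 // pvalX //.
  rewrite (Qoo_u m_gt1 size_f coprime_mr ym genF Qoo_x al) -mulr_natr natz.
  move: Vi0; rewrite zerosE // Ei0 /in_ideal (negPf h0) /=.
  by move: (weight m r g) (Qoo h); clear; lia.
have e1 : (1 <= m * a.-1)%N.
  have : g`_(size g).-1 != 0 by rewrite -lead_coefE lead_coef_eq0.
  by move/strict; rewrite addn1; apply: leq_trans.
have := zero_count m_gt0 gm size_f strict det0 e1 HZ; rewrite cardZ.
apply: leq_trans; rewrite -(cards1 i0).
apply: leq_trans (subset_leq_card _) (leq_card_setU V0 [set i0]).
apply/fintype.subsetP => i Vi; rewrite finset.in_setU; case: (boolP (i \in V0)) => //= NVi.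
by rewrite inE; apply/eqP/ps_inj; rewrite Ei0; apply: Vinf.
Qed.

Lemma ev_inj h h' : RR_space G h -> RR_space G h' -> ev h = ev h' -> h = h'.
Proof.
move=> Gh Gh' E; apply/eqP; rewrite -subr_eq0; apply: contraT => d0.
have := zeros_le (RR_spaceB Gh Gh') d0; rewrite leqNgt.
suff -> : #|zeros (h - h')| = n by rewrite pole_lt_length.
rewrite -[RHS]card_ord; apply: eq_card => i; rewrite !inE evB // E subrr mxE.
by rewrite eqxx.
Qed.

Section Dimension.

Local Notation T := [set v : 'I_a * 'I_m | (m * v.1 + r * v.2 <= m * a.-1)%N].
Local Notation coefs := (pffun_on (0 : k) (mem T) predT).

(** The tests by insub turn the exponents l < a and i < m back into ordinals. *)
Definition bipoly (v : {ffun 'I_a * 'I_m -> k}) : S :=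
  \poly_(i < m) \poly_(l < a)
    (if insub l is Some l' then if insub i is Some i' then v (l', i') else 0 else 0).

Lemma coef_bipoly v (l : 'I_a) (i : 'I_m) : (bipoly v)`_i`_l = v (l, i).
Proof. by rewrite coef_poly ltn_ord coef_poly ltn_ord !valK. Qed.

Lemma bipoly_bound v : v \in coefs -> deg_bound m r a.-1 (bipoly v).
Proof.
move=> /pffun_onP[/fintype.subsetP supp _] i gi.
have im : (i < m)%N by apply: contraNT gi; rewrite -leqNgt => mi; rewrite coef_poly ltnNge mi.
have sa : (size ((bipoly v)`_i)%R <= a)%N by rewrite coef_poly im size_poly.
have la : ((size ((bipoly v)`_i)%R).-1 < a)%N by rewrite prednK ?size_poly_gt0.
have := supp (Ordinal la, Ordinal im); rewrite !inE /= => -> //.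
by rewrite -coef_bipoly /= -lead_coefE lead_coef_eq0.
Qed.

Lemma bipoly_surj g : (size g <= m)%N -> deg_bound m r a.-1 g ->
  exists2 v, v \in coefs & bipoly v = g.
Proof.
move=> gm gB; exists [ffun li : 'I_a * 'I_m => g`_li.2`_li.1].
  apply/pffun_onP; split=> //; apply/fintype.subsetP => -[l i].
  rewrite !inE ffunE /= => gli.
  have gi : g`_i != 0 by apply: contraNneq gli => ->; rewrite coef0.
  have ls : (l < size (g`_i)%R)%N.
    by apply: contraNT gli; rewrite -leqNgt => sl; rewrite nth_default.
  apply: leq_trans (gB i gi); rewrite leq_add2r leq_mul2l -ltnS prednK ?ls ?orbT //.
  exact: leq_ltn_trans ls.
apply/polyP => i; rewrite coef_poly; case: ltnP => im; last first.
  by rewrite nth_default // (leq_trans gm).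
apply/polyP => l; rewrite coef_poly; case: ltnP => la.
  by rewrite (insubT (fun l => l < a)%N la) (insubT (fun i => i < m)%N im) ffunE.
have [->|gi] := eqVneq g`_i 0; first by rewrite coef0.
rewrite nth_default //; apply: leq_trans la.
have : (m * (size (g`_i)%R).-1 <= m * a.-1)%N := leq_trans (leq_addr _ _) (gB i gi).
by rewrite leq_pmul2l //; move: (size _) a_gt0 => s; clear; lia.
Qed.

Lemma bipoly_inj : {in coefs &, injective bipoly}.
Proof.
move=> v w _ _ E; apply/ffunP => -[l i]; by rewrite -!coef_bipoly E.
Qed.

Definition code_fun (v : {ffun 'I_a * 'I_m -> k}) : F := Phi (bipoly v) / u ^+ a.-1.

Lemma code_funE v : code_fun v * u ^+ a.-1 = Phi (bipoly v).
Proof. by rewrite divfK // expf_neq0. Qed.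

Lemma code_fun_RR v : v \in coefs -> RR_space G (code_fun v).
Proof.
move=> Tv; apply: (RRI (g := bipoly v)); first exact: size_poly.
  exact: bipoly_bound.
exact: code_funE.
Qed.

(** L(G) is coordinatized by the coefficients of g and embedded by evaluation.
    Both are compared through cardinals, the constant field being finite. *)
Lemma dim_code : \dim (AG_code ps G) = (a + \sum_(1 <= i < a) (i * m) %/ r)%N.
Proof.
rewrite -card_monomials //; apply/eqP.
rewrite -(eqn_exp2l _ _ (card_finNzRing_gt1 k)) -card_vspace.
have <- : #|coefs| = (#|k| ^ #|T|)%N by rewrite card_pffun_on; congr (_ ^ _)%N; apply: eq_card.
rewrite -(card_in_imset (f := fun v => ev (code_fun v))); last first.
  move=> v w Tv Tw /(ev_inj (code_fun_RR Tv) (code_fun_RR Tw)) E.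
  apply: bipoly_inj => //; apply/eqP; rewrite -subr_eq0; apply/eqP.
  apply: (xyeval_inj m_gt0 size_f coprime_mr ym Qoo_x).
    by rewrite (leq_trans (size_polyD _ _)) // size_polyN geq_max !size_poly.
  by rewrite xyevalB -!code_funE E subrr.
apply/eqP/eq_card => c; apply/idP/imsetP => [|[v Tv ->]]; last first.
  by apply/mem_code; exists (code_fun v) => //; apply: code_fun_RR.
case/mem_code => h Gh ->; have [g [gm gB E]] := RRE Gh.
have [v Tv Ev] := bipoly_surj gm gB; exists v => //; congr ev.
by apply: (mulIf (expf_neq0 a.-1 u0)); rewrite code_funE Ev.
Qed.

End Dimension.
Section MinDistance.

Local Notation C := (AG_code ps G).

Lemma RR_xpoly (p : {poly k}) : (size p <= a)%N ->
  RR_space G (xpoly F p / u ^+ a.-1).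
Proof.
move=> pa; apply: (RRI (g := p%:P)).
- by rewrite (leq_trans (size_polyC_leq1 _)).
- move=> [|i]; rewrite coefC ?eqxx //= muln0 addn0 leq_mul2l => _.
  by apply/orP; right; move: (size p) pa => s; clear; lia.
- by rewrite divfK ?expf_neq0 // xyevalC.
Qed.

Lemma RR0 : RR_space G 0. Proof. by left. Qed.

Lemma code_dist_ge v w : v \in C -> w \in C -> v != w ->
  (n <= hamming_dist v w + m * a.-1)%N.
Proof.
case/mem_code => h Gh -> /mem_code[h' Gh' ->] hh'.
rewrite -[X in (X <= _)%N](code_dist Gh Gh') leq_add2l; apply: zeros_le; first exact: RR_spaceB.
by rewrite subr_eq0; apply: contraNneq hh' => ->.
Qed.

(** A split value is not a root of f, because there is only one place above a
    root.  So full_fibre_rational applies, and Q, which lies above a root of f, is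
    not among the places found. *)
Lemma split_fibre c : splits_completely_at F c -> exists s : seq 'I_n,
  [/\ uniq s, size s = m & {in s, forall i, has_value (ps i) x c}] /\ c != al.
Proof.
case=> p pc [s [us sm sE]]; rewrite (dim_curve m_gt0 size_f coprime_mr ym genF Qoo_x) in sm.
have Hs P : P \in s -> has_value P x c.
  move=> /sE/(_ _ pc) Pc.
  have : in_ideal P (xpoly F ('X - c%:P)) by [].
  by rewrite XsubC_ideal.
have fc : f.[c] != 0.
  apply/negP => /eqP/rootP fc; case: s us sm Hs {sE} => [|P [|P' s]] /=.
  - by move=> _ m0; move: m_gt1; rewrite -m0.
  - by move=> _ m1; move: m_gt1; rewrite -m1.
  rewrite !inE negb_or => /andP[/andP[/eqP PP' _] _] _ Hs; apply: PP'.
  have HP := Hs P (mem_head _ _).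
  have HP' : has_value P' x c by apply: Hs; rewrite !inE eqxx orbT.
  exact: (centered_unique m_gt0 f0 ym sepf mk kerF fracF
    (centered_ramified ym HP fc) (centered_ramified ym HP' fc)).
have cal : c != al by apply: contraNneq fc => ->; apply/eqP/rootP.
have Hrat := full_fibre_rational m_gt0 f0 ym sepf mk kerF fracF fc us sm Hs.
have /choice[idx Hidx] P : exists i, P \in s -> ps i = P.
  (* Places outside s are sent to an arbitrary index; there is one as n > 0. *)
  have [Ps|_] := boolP (P \in s); last first.
    by exists (Ordinal (leq_ltn_trans (leq0n _) pole_lt_length)).
  have [|i Ei] := (psE P).2; last by exists i.
  split; first exact: Hrat.
  move=> PQ; have := Hs P Ps; rewrite PQ => /has_value_unique/(_ Q_al) E.
  by rewrite E eqxx in cal.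
exists (map idx s); split=> //; split.
- rewrite map_inj_in_uniq // => P P' Ps Ps' E.
  by rewrite -(Hidx P Ps) -(Hidx P' Ps') E.
- by rewrite size_map.
- by move=> i /mapP[P Ps ->]; rewrite Hidx //; apply: Hs.
Qed.

(** Take for h the product of the (x - c)/(x - al) over the given split values:
    each c contributes the m places above it. *)
Lemma many_zeros (cs : {set k}) : #|cs| = a.-1 ->
  {in cs, forall c, splits_completely_at F c} ->
  exists h, [/\ RR_space G h, h != 0 & (m * a.-1 <= #|zeros h|)%N].
Proof.
move=> ca Hcs; pose q := \prod_(c in cs) ('X - c%:P).
have q0 : q != 0 by apply/prodf_neq0 => c _; rewrite polyXsubC_eq0.
have qa : (size q <= a)%N.
  by rewrite /q -big_enum size_prod_XsubC -cardE ca prednK.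
have Gh := RR_xpoly qa; set h := xpoly F q / _ in Gh.
exists h; split=> //; first by rewrite mulf_neq0 ?invr_eq0 ?(expf_neq0 _ u0) ?xpoly_eq0.
rewrite -sum1_card (partition_big (fun i => ev x 0 i) xpredT) //=.
rewrite (bigID (mem cs)) /=; apply: leq_trans (leq_addr _ _).
rewrite -ca mulnC -sum_nat_const; apply: leq_sum => c cc.
have [s [[us sm Hs] cal]] := split_fibre (Hcs c cc).
rewrite sum1dep_card -sm cardE; apply: uniq_leq_size us _ => i si.
have Hi := Hs i si; have Ri := in_ring_of_value Hi.
rewrite mem_enum inE; apply/andP; split.
  rewrite zerosE // /h mulrC; apply: in_idealMr.
    rewrite /in_ring pvalV pvalX // (pval_u m_gt1 size_f coprime_mr sepf mk ym genF Qoo_x root_al Q_al Ri).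
      by rewrite mul0rn oppr0 lexx orbT.
    exact: ps_neq_Q.
  rewrite /q (bigD1 c) //= rmorphM; apply: in_idealMl; last exact: in_ring_xpoly.
  by rewrite XsubC_ideal.
rewrite mxE; apply/eqP/xget_unique => // b Hb; exact: has_value_unique Hb Hi.
Qed.

Lemma code_min_distance : exists d : nat,
  [/\ is_min_distance C d, (n <= d + m * a.-1)%N &
    (a.-1 <= #|[pred c : k | `[< splits_completely_at F c >]]|)%N ->
    (d + m * a.-1 = n)%N].
Proof.
have attained h : RR_space G h -> h != 0 -> ev h != ev 0.
  by move=> Gh; apply: contra_neq; apply: ev_inj => //; apply: RR0.
have inC h : RR_space G h -> ev h \in C by move=> Gh; apply/mem_code; exists h.
pose D d := [exists v : 'rV[k]_n, exists w : 'rV[k]_n,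
  [&& v \in C, w \in C, v != w & hamming_dist v w == d]].
have exD : exists d, D d.
  have G1 := @RR_xpoly 1 _; rewrite size_poly1 in G1; have {}G1 := G1 a_gt0.
  exists (hamming_dist (ev (xpoly F 1 / u ^+ a.-1)) (ev 0)).
  apply/existsP; exists (ev (xpoly F 1 / u ^+ a.-1)); apply/existsP; exists (ev 0).
  rewrite eqxx andbT !inC //=; last exact: RR0.
  by apply: attained => //; rewrite mulf_neq0 ?invr_eq0 ?(expf_neq0 _ u0) ?xpoly_eq0 ?oner_eq0.
have [d /existsP[v /existsP[w /and4P[vC wC vw /eqP dvw]]] dmin] := ex_minnP exD.
have dle v' w' : v' \in C -> w' \in C -> v' != w' -> (d <= hamming_dist v' w')%N.
  move=> v'C w'C vw'; apply: dmin; apply/existsP; exists v'; apply/existsP; exists w'.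
  by rewrite v'C w'C vw' eqxx.
have dge : (n <= d + m * a.-1)%N by rewrite -dvw; apply: code_dist_ge.
exists d; split=> //; first by split=> //; exists v, w.
move=> many.
have /card_geqP[s [us ss sub]] := many.
have [||h [Gh h0 zh]] := @many_zeros [set c in s].
- by rewrite cardsE (card_uniqP us).
- by move=> c; rewrite inE => /sub; rewrite inE.
apply/eqP; rewrite eqn_leq dge andbT -(code_dist Gh RR0) subr0; apply: leq_add => //.
by apply: dle; rewrite ?inC ?attained //; apply: RR0.
Qed.

End MinDistance.

End Code.

(** * Degrees of divisors, and the theorem *)

Lemma coeff_sum_places (k E : fieldType) (iota : {rmorphism k -> E}) n
    (ps : 'I_n -> place iota) P : injective ps ->
  coeff P (\sum_i << ps i >> : {freeg (place iota)}) = (P \in codom ps)%:R.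
Proof.
move=> inj; rewrite raddf_sum /=; under eq_bigr do rewrite coeffU mul1r.
case: (boolP (P \in codom ps)) => [/codomP[i ->]|NP].
  rewrite (bigD1 i) //= eqxx big1 ?addr0 // => j ji.
  by rewrite (negPf (contra_neq (@inj j i) ji)).
rewrite big1 // => i _; case: eqP => // E'.
by case/negP: NP; rewrite -E' codom_f.
Qed.

Lemma div_degree_rational_sum (k : finFieldType) (E : fieldType)
    (iota : {rmorphism k -> E}) n (ps : 'I_n -> place iota) :
  injective ps -> (forall i, rational (ps i)) -> div_degree (sum_places ps) = n%:Z.
Proof.
move=> inj rat; rewrite /div_degree /sum_places; set D := \sum_i _.
have pD : perm_eq (dom D) (codom ps).
  apply: uniq_perm; rewrite ?uniq_dom ?codom_uniq //; first exact/injectiveP.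
  by move=> P; rewrite mem_dom coeff_sum_places //; case: (P \in _).
rewrite (perm_big _ pD) big_image /= -[RHS]natz -[n in RHS]card_ord -sumr_const.
apply: eq_bigr => i _; rewrite coeff_sum_places // codom_f.
by rewrite rat.
Qed.

Lemma div_degreeU (k E : fieldType) (iota : {rmorphism k -> E}) (P : place iota) (c : int) :
  rational P -> div_degree << c *g P >> = c.
Proof.
move=> rP; have [->|c0] := eqVneq c 0; first by rewrite freegU0 /div_degree dom0 big_nil.
by rewrite /div_degree domU // big_seq1 coeffU eqxx rP !mulr1.
Qed.

Lemma lies_over_pole (k : fieldType) (F : fieldExtType {fraction {poly k}})
    (P : place (const_ext F)) p : lies_over P p -> is_pole_of_x p -> P (xpoly F 'X) < 0.
Proof.
move=> Pp px; have : in_ideal p (tofrac 'X)^-1.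
  by rewrite /in_ideal pvalV oppr_gt0 [_ < 0]px orbT.
move/Pp; set w := (_%:A : F) => Pw.
have x0 : xpoly F 'X != 0 by rewrite xpoly_eq0 polyX_eq0.
have E : w * xpoly F 'X = 1.
  by rewrite /w /xpoly -scalerAl mul1r scalerA mulVf ?scale1r // tofrac_eq0 polyX_eq0.
have w0 : w != 0 by apply: contra_eq_neq E => ->; rewrite mul0r eq_sym oner_eq0.
have := pvalM P w0 x0; rewrite E pval1.
move: Pw; rewrite /in_ideal (negPf w0) /=.
by move: (P w) (P _); clear; lia.
Qed.

Theorem theorem5p1
  (k : finFieldType) (p : nat) (hp : p \in [pchar k])
  (f : {poly k}) (r : nat) (hf : separable_poly f)
  (hr : size f = r.+1) (hr3 : (3 <= r)%N)
  (m : nat) (hm2 : (2 <= m)%N) (hpm : ~~ (p %| m)%N) (hmr : coprime m r)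
  (* F = k(x, y) with y^m = f(x) *)
  (F : fieldExtType {fraction {poly k}}) (y : F)
  (hy : y ^+ m = (tofrac f)%:A) (hF : <<1; y>>%VS = fullv)
  (Poo : place (const_ratfun k)) (hPoo : is_pole_of_x Poo)
  (Qoo : place (const_ext F)) (hQoo : lies_over Qoo Poo)
  (Q : place (const_ext F)) (hQ : rational Q) (hQQoo : Q <> Qoo)
  (hQram : totally_ramified Q)
  (a : nat) (ha2 : (2 <= a)%N) (har : (a <= r - 1)%N)
  (* P_1, ..., P_n enumerates the rational places other than Q *)
  (n : nat) (ps : 'I_n -> place (const_ext F)) (hps : injective ps)
  (hpsE : forall P, (exists i, ps i = P) <-> rational P /\ P <> Q) :
  let G := << ((a * m)%:Z - ((a * m) %/ r)%:Z - 1)%R *g Q >> in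
  let D := sum_places ps in
  let N := div_degree D in
  let C := AG_code ps G in
  div_degree G < N ->
  [/\ n%:Z = N,
      \dim C = (a + \sum_(1 <= i < a) (i * m) %/ r)%N
    & exists d : nat,
      [/\ is_min_distance C d,
          N - (m * (a - 1))%N%:Z <= d%:Z
        & (a - 1 <= #|[pred c : k | `[< splits_completely_at F c >]]|)%N ->
          d%:Z = N - (m * (a - 1))%N%:Z]].
Proof.
have a_gt0 : (0 < a)%N by apply: leq_trans ha2.
have a_ltr : (a < r)%N by move: har hr3; clear; lia.
have mk : (m%:R : k) != 0 by rewrite -(dvdn_pcharf hp).
have Qoo_x := lies_over_pole hQoo hPoo.
have [al root_al Q_al] :=
  totally_ramified_root hm2 hr hmr mk hy hF Qoo_x hQ hQQoo hQram.
have EN : div_degree (sum_places ps) = n%:Z.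
  by apply: div_degree_rational_sum => // i; have [] := (hpsE (ps i)).1 (ex_intro _ i erefl).
move=> G D N C; rewrite /N /D EN /G div_degreeU // => cQ_ltn; split=> //.
  exact: (dim_code hm2 hr hmr hf mk hy hF Qoo_x root_al Q_al a_gt0 a_ltr hps hpsE cQ_ltn).
have [d [dC dge dsplit]] :=
  code_min_distance hm2 hr hmr hf mk hy hF Qoo_x root_al Q_al a_gt0 a_ltr hps hpsE cQ_ltn.
exists d; split=> //; rewrite subn1.
  by move: dge; move: (m * a.-1)%N; clear; lia.
by move/dsplit; move: (m * a.-1)%N; clear; lia.
Qed.
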